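(* Let $\pi\colon\mathbb{R}\to\mathbb{R}$ be a minimal valid function (for a fixed $f\in\mathbb{R}\setminus\mathbb{Z}$) such that (1) $\pi$ is piecewise linear and continuous from at least one side of the origin; (2) its breakpoint set $B$ is minimal; (3) the moves closure $\mathrm{clsemi}_A(\Omega^0)$ of its initial move ensemble has a finite presentation $(\Omega,\mathcal{C})$ in reduced form. Let $\mathcal{T}$ be the refined complex defined in the context. A function $\tilde\pi_{\mathcal{T}}\colon\mathbb{R}\to\mathbb{R}$ is a finite-dimensional perturbation, $\tilde\pi_{\mathcal{T}}\in\tilde\Pi^\pi_{\mathcal{T}}$, if and only if $\tilde\pi_{\mathcal{T}}$ is piecewise linear over $\mathcal{T}$ and satisfies the following conditions: (i) $\tilde\pi_{\mathcal{T}}(0)=0$ and $\tilde\pi_{\mathcal{T}}(f)=0$; (ii) $\tilde\pi_{\mathcal{T}}(x)=\tilde\pi_{\mathcal{T}}(x+t)$ for all $x\in\mathbb{R}$, $t\in\mathbb{Z}$; (iii) for any additive vertex $(x,y)$ of $\Delta\mathcal{T}$ and any face $F\in\Delta\mathcal{T}$ such that $(x,y)\in F$, $\Delta\pi_F(x,y)=0$ implies $\Delta(\tilde\pi_{\mathcal{T}})_F(x,y)=0$.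
   Context: **Moves.** For $t,r\in\mathbb{R}$ let $\tau_t(x)=x+t$ (translation) and $\rho_r(x)=r-x$ (reflection). A move $\gamma|_D$ is the restriction of a translation or reflection $\gamma$ to a set $D\subseteq\mathbb{R}$ that is an open interval or empty, viewed as a partial bijection $D\to\gamma(D)$ (all empty translations are identified to one object, all empty reflections to another, distinct object). Composition: $\gamma_2|_{D_2}\circ\gamma_1|_{D_1}=(\gamma_2\circ\gamma_1)|_{D_1\cap\gamma_1^{-1}(D_2)}$; inverse: $(\gamma|_D)^{-1}=\gamma^{-1}|_{\gamma(D)}$. A move ensemble is a set of moves. For $O\subseteq\mathbb{R}^2$, $\mathrm{moves}_+(O)$ (resp. $\mathrm{moves}_-(O)$) is the set of translation (resp. reflection) moves whose graph $\{(x,\gamma(x)):x\in D\}$ is contained in $O$, and $\mathrm{moves}(O)=\mathrm{moves}_+(O)\cup\mathrm{moves}_-(O)$. **Closed move semigroups.** Let $A\subseteq\mathbb{R}$ be open. A closed move semigroup (with respect to $A$) is a move ensemble $\Gamma$ closed under composition and inverse such that: (restrict) if $\gamma|_D\in\Gamma$ and $D'\subseteq D$ is an open interval or empty then $\gamma|_{D'}\in\Gamma$; (continuation) if $\gamma|_I\in\Gamma$ for all $I$ in a family whose union $D$ is an interval, then $\gamma|_D\in\Gamma$; (extend$_A$) if $\gamma|_{D^i}\in\Gamma$ for all $i$ in an index set and $D$, empty or an open interval, satisfies $D\subseteq\mathrm{cl}(\bigcup_i D^i)\cap A\cap\gamma^{-1}(A)$, then $\gamma|_D\in\Gamma$; (lim)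 if $D$ is an open interval, $\gamma^i|_D\in\Gamma$ for all $i\in\mathbb{N}$ and $\gamma^i\to\gamma$ (all but finitely many $\gamma^i$ are of the same type as $\gamma$, and their parameters $t$ resp. $r$ converge to that of $\gamma$), then $\gamma|_D\in\Gamma$; (kaleido) for open intervals $D,I$: $\mathrm{moves}_+(D\times I)\subseteq\Gamma$ iff $\mathrm{moves}_-(D\times I)\subseteq\Gamma$. For an ensemble $\Omega'$ all of whose domains and images lie in $A$, the moves closure $\mathrm{clsemi}_A(\Omega')$ is the smallest closed move semigroup containing $\Omega'$. **Finite presentations.** $\mathrm{join}(\Omega')$ is the smallest ensemble containing $\Omega'$ satisfying (restrict) and (continuation). For a finite list $\mathcal{C}=\{C_1,\dots,C_k\}$ where each $C_i$ is a finite union of disjoint open intervals, $\mathrm{moves}(\mathcal{C})=\bigcup_i\mathrm{moves}(C_i\times C_i)$. A finite presentation of an ensemble $\Gamma$ satisfying (restrict), (continuation), (kaleido) is a pair $(\Omega,\mathcal{C})$ with $\Omega$ a finite ensemble and $\Gamma=\mathrm{join}(\Omega\cup\mathrm{moves}(\mathcal{C}))$. It is in reduced form if every move of $\Omega$ is maximal in $\Gamma$ with respect to restriction and is not in $\mathrm{join}(\mathrm{moves}(\mathcal{C}))$. **Minimal valid functions.** Fix $f\in\mathbb{R}\setminus\mathbb{Z}$. Write $\Delta\theta(x,y)=\theta(x)+\theta(y)-\theta(x+y)$. A function $\pi\colon\mathbb{R}\to\mathbb{R}$ is minimal valid iff $\pi\ge0$, $\pi$ is $\mathbb{Z}$-periodic,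 $\pi(0)=0$, $\pi(f)=1$, $\Delta\pi(x,y)\ge0$ and $\Delta\pi(x,f-x)=0$ for all $x,y\in\mathbb{R}$. The space of effective perturbations is $\tilde\Pi^\pi=\{\tilde\pi\colon\mathbb{R}\to\mathbb{R}\mid\exists\epsilon>0:\ \pi\pm\epsilon\tilde\pi\text{ are minimal valid}\}$. **Piecewise linearity.** For $0=x_0<\dots<x_n=1$ let $B=\{x_0,\dots,x_{n-1}\}+\mathbb{Z}$, and let $\mathcal{P}_B$ be the complex consisting of the empty face, the singletons $\{x\}$, $x\in B$, and the closed intervals between consecutive points of $B$. A function is piecewise linear over $\mathcal{P}_B$ if on the relative interior of each face it agrees with an affine function (jumps at points of $B$ are allowed). $B$ is minimal if $\mathcal{P}_B$ is the coarsest such complex over which $\pi$ is piecewise linear. For a complex $\mathcal{P}$ of this kind, $\Delta\mathcal{P}$ is the complex of faces $F(I,J,K)=\{(x,y):x\in I,y\in J,x+y\in K\}$, $I,J,K\in\mathcal{P}$. For a function $\theta$ piecewise linear over $\mathcal{P}$, a face $F\in\Delta\mathcal{P}$ and $(x,y)\in F$, $\Delta\theta_F(x,y)$ is the limit of $\Delta\theta(u,v)$ as $(u,v)\to(x,y)$ with $(u,v)\in\mathrm{relint}(F)$. A vertex $(x,y)$ of $\Delta\mathcal{P}$ is additive if $\Delta\pi_F(x,y)=0$ for some face $F\ni(x,y)$ of $\Delta\mathcal{P}$. **Initial moves.** $A$ is the maximal open subset of $(0,1)$ on which $\pi$ is continuous. $\Omega^0$ consists of the empty moves, of all the following moves with $D,\gamma(D)\subseteq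 A$, $D$ an open interval, and of their inverses: $\tau_t|_D$, $t\in(-1,1)$, with $\Delta\pi(x,t)=0$ for all $x\in D$; $\rho_r|_D$, $r\in(0,2)$, with $\Delta\pi(x,r-x)=0$ for all $x\in D$; $\tau_{\bar t}|_D$, $\bar t\in(-1,1)$, such that for all $x\in D$, $\lim_{t\to\bar t^+}\Delta\pi(x,t)=0$ or $\lim_{t\to\bar t^-}\Delta\pi(x,t)=0$; $\rho_{\bar r}|_D$, $\bar r\in(0,2)$, such that for all $x\in D$, $\lim_{r\to\bar r^+}\Delta\pi(x,r-x)=0$ or $\lim_{r\to\bar r^-}\Delta\pi(x,r-x)=0$. **Refined complex.** With $(\Omega,\mathcal{C})$ the reduced finite presentation of $\mathrm{clsemi}_A(\Omega^0)$, let $C=C_1\cup\dots\cup C_k$ (covered points), $U=(0,1)\setminus\mathrm{cl}(C)$ (uncovered points), $X=\{0\}\cup\partial C\cup\{1\}$; $V=\{x,y,x+y: (x,y)\text{ additive vertex of }\Delta\mathcal{P}_B\}\cap[0,1]$; $Y=(V\cap U)\cup\{\gamma(x):x\in V\cap U,\ x\in D,\ \gamma|_D\in\Omega\}$; $Z=\{x\in U: x=\rho|_D(x)\text{ for some reflection move }\rho|_D\in\Omega \text{ with } x\in D\}$; $B'=(X\cup Y\cup Z)+\mathbb{Z}$; $\mathcal{T}=\mathcal{P}_{B'}$ (a refinement of $\mathcal{P}_B$). **Finite-dimensional perturbations.** $\tilde\Pi^\pi_{\mathcal{T}}=\{\tilde\pi\in\tilde\Pi^\pi:\tilde\pi\text{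 is piecewise linear over }\mathcal{T}\}$. *)

(* Defs.v *)
From HB Require Import structures.
From mathcomp Require Import all_boot all_order all_algebra.
From mathcomp Require Import boolp classical_sets functions cardinality.
From mathcomp Require Import reals topology normedtype.

Set Implicit Arguments.
Unset Strict Implicit.
Unset Printing Implicit Defensive.

Import Order.TTheory GRing.Theory Num.Theory.
Import numFieldNormedType.Exports.

Local Open Scope classical_set_scope.
Local Open Scope ring_scope.

Variant umap (R : realType) : Type := Tau of R | Rho of R.

Definition uapp (R : realType) (g : umap R) (x : R) : R :=
  match g with Tau t => x + t | Rho r => r - x end.
Coercion uapp : umap >-> Funclass.

Section Moves.
Variable R : realType.
Implicit Types (g : umap R) (D I : set R) (O : set (R * R)).

Definition is_refl g : bool := if g is Rho _ then true else false.

Definition param g : R := match g with Tau t => t | Rho r => r end.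

Definition ucomp g2 g1 : umap R :=
  match g2, g1 with
  | Tau t2, Tau t1 => Tau (t1 + t2)
  | Tau t2, Rho r1 => Rho (r1 + t2)
  | Rho r2, Tau t1 => Rho (r2 - t1)
  | Rho r2, Rho r1 => Tau (r2 - r1)
  end.

Lemma ucompE g2 g1 : ucomp g2 g1 =1 g2 \o g1.
Proof.
case: g2 g1 => [t2|r2] [t1|r1] x /=; rewrite ?addrA //.
- by rewrite addrAC.
- by rewrite opprD addrA addrAC.
- by rewrite opprB addrCA addrA addrAC.
Qed.

Definition uinv g : umap R :=
  match g with Tau t => Tau (- t) | Rho r => Rho r end.

Lemma uinvK g : cancel g (uinv g).
Proof. by case: g => [t|r] x /=; rewrite ?addrK // subKr. Qed.

Definition open_itv D := [/\ open D, is_interval D & D !=set0].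

Definition open_itv_or_empty D := open_itv D \/ D = set0.

(* A move is encoded by its type (true for reflections) and its graph.  For a
   nonempty open interval D both gamma and D are determined by the graph, so
   the only identifications are those of all empty translations and of all
   empty reflections, which are kept distinct by the type. *)
Definition move : Type := (bool * set (R * R))%type.

Definition restr g D : move := (is_refl g, [set p | D p.1 /\ p.2 = g p.1]).

Definition is_move (m : move) : Prop :=
  exists g D, open_itv_or_empty D /\ m = restr g D.

Definition ensemble (G : set move) : Prop := G `<=` is_move.

Definition moves_pl O : set move :=
  [set m | exists t D,
    [/\ open_itv_or_empty D, m = restr (Tau t) D & m.2 `<=` O]].

Definition moves_mi O : set move :=
  [set m | exists r D,
    [/\ open_itv_or_empty D, m = restr (Rho r) D & m.2 `<=` O]].

Definition moves O : set move := moves_pl O `|` moves_mi O.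

Definition comp_closed (G : set move) : Prop :=
  forall g1 D1 g2 D2, G (restr g1 D1) -> G (restr g2 D2) ->
    G (restr (ucomp g2 g1) (D1 `&` g1 @^-1` D2)).

Definition inv_closed (G : set move) : Prop :=
  forall g D, G (restr g D) -> G (restr (uinv g) (g @` D)).

Definition ax_restrict (G : set move) : Prop :=
  forall g D D', G (restr g D) -> D' `<=` D -> open_itv_or_empty D' ->
    G (restr g D').

Definition ax_continuation (G : set move) : Prop :=
  forall g (F : set (set R)), (forall I, F I -> G (restr g I)) ->
    open_itv (\bigcup_(I in F) I) -> G (restr g (\bigcup_(I in F) I)).

Definition ax_extend (A : set R) (G : set move) : Prop :=
  forall g (F : set (set R)) D, (forall I, F I -> G (restr g I)) ->
    open_itv_or_empty D ->
    D `<=` closure (\bigcup_(I in F) I) `&` A `&` g @^-1` A ->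
    G (restr g D).

Definition umap_cvg (gs : nat -> umap R) g : Prop :=
  (\forall n \near \oo, is_refl (gs n) = is_refl g) /\
  (fun n => param (gs n)) @ \oo --> param g.

Definition ax_lim (G : set move) : Prop :=
  forall (gs : nat -> umap R) g D, open_itv D ->
    (forall n, G (restr (gs n) D)) -> umap_cvg gs g -> G (restr g D).

Definition ax_kaleido (G : set move) : Prop :=
  forall D I, open_itv D -> open_itv I ->
    (moves_pl (D `*` I) `<=` G <-> moves_mi (D `*` I) `<=` G).

Record closed_semigroup (A : set R) (G : set move) : Prop := ClosedSemigroup {
  cs_ensemble : ensemble G;
  cs_comp : comp_closed G;
  cs_inv : inv_closed G;
  cs_restrict : ax_restrict G;
  cs_continuation : ax_continuation G;
  cs_extend : ax_extend A G;
  cs_lim : ax_lim G;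
  cs_kaleido : ax_kaleido G }.

Definition clsemi (A : set R) (W : set move) : set move :=
  smallest (closed_semigroup A) W.

Definition join (W : set move) : set move :=
  smallest [set G | [/\ ensemble G, ax_restrict G & ax_continuation G]] W.

Definition fin_union_open_itv D : Prop :=
  exists n (J : 'I_n -> set R),
    [/\ forall i, open_itv (J i), trivIset setT J & D = \bigcup_i J i].

Definition moves_seq (C : seq (set R)) : set move :=
  [set m | exists2 D, D \in C & moves (D `*` D) m].

Record finite_presentation (G W : set move) (C : seq (set R)) : Prop :=
  FinitePresentation {
    fp_restrict : ax_restrict G;
    fp_continuation : ax_continuation G;
    fp_kaleido : ax_kaleido G;
    fp_ensemble : ensemble W;
    fp_finite : finite_set W;
    fp_components : forall D, D \in C -> fin_union_open_itv D;
    fp_join : G = join (W `|` moves_seq C) }.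

(* Restriction order: on encoded moves, same type and smaller graph. *)
Definition move_le (m m' : move) : Prop := m.1 = m'.1 /\ m.2 `<=` m'.2.

Definition reduced_presentation (G W : set move) (C : seq (set R)) : Prop :=
  finite_presentation G W C /\
  forall m, W m ->
    (forall m', G m' -> move_le m m' -> m' = m) /\ ~ join (moves_seq C) m.

End Moves.

Section Minimal.
Variable R : realType.
Implicit Types (f : R) (theta pi : R -> R).

Definition delta theta (x y : R) : R := theta x + theta y - theta (x + y).

Record minimal_valid f pi : Prop := MinimalValid {
  mv_ge0 : forall x, 0 <= pi x;
  mv_periodic : forall x (z : int), pi (x + z%:~R) = pi x;
  mv_at0 : pi 0 = 0;
  mv_atf : pi f = 1;
  mv_subadditive : forall x y, 0 <= delta pi x y;
  mv_symmetric : forall x, delta pi x (f - x) = 0 }.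

Definition effective_perturbations f pi : set (R -> R) :=
  [set theta | exists2 eps : R, 0 < eps &
    minimal_valid f (fun x => pi x + eps * theta x) /\
    minimal_valid f (fun x => pi x - eps * theta x)].

Definition affine_set (E : normedModType R) (S : set E) : Prop :=
  forall x y (l : R), S x -> S y -> S (l *: x + (1 - l) *: y).

Definition affine_hull (E : normedModType R) (S : set E) : set E :=
  smallest (@affine_set E) S.

Definition relint (E : normedModType R) (S : set E) : set E :=
  [set x | S x /\ \forall y \near x, affine_hull S y -> S y].

Definition add_Z (S : set R) : set R :=
  [set y | exists2 x, S x & exists z : int, y = x + z%:~R].

(* B = {x_0, ..., x_(n-1)} + Z with 0 = x_0 < ... < x_n = 1; the elements
   x_0, ..., x_(n-1) are listed in [0 :: s]. *)
Definition breakpoint_set (B : set R) : Prop :=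
  exists s : seq R, sorted <%R (0 :: rcons s 1) /\
    B = add_Z [set x | x \in 0 :: s].

Definition complex (B : set R) : set (set R) :=
  [set I | [\/ I = set0,
               exists2 x, B x & I = [set x] |
               exists a b, [/\ B a, B b, a < b,
                 (forall y, a < y < b -> ~ B y) & I = `[a, b]%classic]]].

Definition piecewise_linear (P : set (set R)) theta : Prop :=
  forall I, P I ->
    exists a b : R, forall x, relint I x -> theta x = a * x + b.

Definition refines (P' P : set (set R)) : Prop :=
  forall I, P' I -> exists2 J, P J & I `<=` J.

Definition minimal_breakpoints pi (B : set R) : Prop :=
  [/\ breakpoint_set B, piecewise_linear (complex B) pi &
      forall B', breakpoint_set B' -> piecewise_linear (complex B') pi ->
        refines (complex B') (complex B)].

Definition face (I J K : set R) : set (R * R) :=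
  [set p | [/\ I p.1, J p.2 & K (p.1 + p.2)]].

Definition dcomplex (P : set (set R)) : set (set (R * R)) :=
  [set F | exists I J K, [/\ P I, P J, P K & F = face I J K]].

(* Delta theta_F (p) = l, stated as convergence rather than through the total
   operator [lim], which would return a junk value if there were no limit. *)
Definition delta_face_eq theta (F : set (R * R)) (p : R * R) (l : R) : Prop :=
  (fun q : R * R => delta theta q.1 q.2) @ within (relint F) (nbhs p) --> l.

Definition vertex (P : set (set R)) (p : R * R) : Prop := dcomplex P [set p].

Definition additive_vertex (P : set (set R)) pi (p : R * R) : Prop :=
  vertex P p /\
  exists F, [/\ dcomplex P F, F p & delta_face_eq pi F p 0].

Definition cont_set pi : set R :=
  \bigcup_(O in [set O : set R | [/\ open O, O `<=` `]0, 1[%classic &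
                   forall x, O x -> {for x, continuous pi}]]) O.

Definition init_cond pi (g : umap R) (D : set R) : Prop :=
  match g with
  | Tau t => -1 < t < 1 /\
      ((forall x, D x -> delta pi x t = 0) \/
       (forall x, D x -> delta pi x u @[u --> t^'+] --> (0 : R) \/
                         delta pi x u @[u --> t^'-] --> (0 : R)))
  | Rho r => 0 < r < 2 /\
      ((forall x, D x -> delta pi x (r - x) = 0) \/
       (forall x, D x -> delta pi x (u - x) @[u --> r^'+] --> (0 : R) \/
                         delta pi x (u - x) @[u --> r^'-] --> (0 : R)))
  end.

Definition init_dom pi (g : umap R) (D : set R) : Prop :=
  [/\ open_itv D, D `<=` cont_set pi, g @` D `<=` cont_set pi &
      init_cond pi g D].

Definition initial_moves pi : set (move R) :=
  [set m | [\/ m = restr (Tau 0) set0 \/ m = restr (Rho 0) set0,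
    exists g D, init_dom pi g D /\ m = restr g D |
    exists g D, init_dom pi g D /\ m = restr (uinv g) (g @` D)]].

Definition covered (C : seq (set R)) : set R :=
  [set x | exists2 D, D \in C & D x].

Definition uncovered (C : seq (set R)) : set R :=
  `]0, 1[%classic `\` closure (covered C).

Definition Xset (C : seq (set R)) : set R :=
  [set 0] `|` (closure (covered C) `\` interior (covered C)) `|` [set 1].

Definition Vset pi (B : set R) : set R :=
  [set v | exists x y, additive_vertex (complex B) pi (x, y) /\
             [\/ v = x, v = y | v = x + y]] `&` `[0, 1]%classic.

Definition Yset pi (B : set R) (W : set (move R)) (C : seq (set R)) : set R :=
  let VU := Vset pi B `&` uncovered C in
  VU `|` [set y | exists x g D, [/\ VU x, D x, W (restr g D) & y = g x]].

Definition Zset (W : set (move R)) (C : seq (set R)) : set R :=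
  [set x | uncovered C x /\
     exists r D, [/\ W (restr (Rho r) D), D x & x = Rho r x]].

Definition refined_breakpoints pi (B : set R) (W : set (move R))
    (C : seq (set R)) : set R :=
  add_Z (Xset C `|` Yset pi B W C `|` Zset W C).

Definition refined_complex pi (B : set R) (W : set (move R))
    (C : seq (set R)) : set (set R) :=
  complex (refined_breakpoints pi B W C).

Definition fin_dim_perturbations f pi (T : set (set R)) : set (R -> R) :=
  [set theta | effective_perturbations f pi theta /\
               piecewise_linear T theta].

End Minimal.

(* Main.v *)
(* If pi +- eps * theta are minimal valid, then |Delta theta| <= Delta pi / eps
   pointwise, so zero limits of Delta pi are inherited by Delta theta.

   Conversely, it suffices to find M with |Delta theta| <= M * Delta pi
   everywhere: then pi +- eps * theta is subadditive and symmetric for small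
   eps, and nonnegative because a bounded subadditive function is.  On the
   relative interior of a face of the complex Delta T both Delta pi and
   Delta theta are affine, and an affine function on a face is bounded below by
   its value at some vertex of that face, where condition (iii) applies.  Modulo
   Z there are finitely many pairs of a face and one of its vertices, whence M.

   This needs pi to be piecewise linear over T, that is, B to be contained in
   the refined breakpoint set.  The only breakpoints for which this is not
   immediate are those in the covered set.  The moves between continuity points
   of pi which match the slopes of pi form a closed semigroup containing the
   initial moves; hence pi has a single slope around a covered point and is
   continuous there, so that such a point is not a breakpoint by minimality. *)
Require Import Defs.
From mathcomp Require Import all_boot all_order all_algebra.
From mathcomp Require Import boolp classical_sets functions cardinality.
From mathcomp Require Import reals topology normedtype.
From mathcomp Require Import ring lra.

Set Implicit Arguments.
Unset Strict Implicit.
Unset Printing Implicit Defensive.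

Import Order.TTheory GRing.Theory Num.Theory.
Import numFieldNormedType.Exports.

Local Open Scope classical_set_scope.
Local Open Scope ring_scope.

(** * Relative interiors and faces *)

Lemma sub_affine_hull (R : realType) (E : normedModType R) (S : set E) :
  S `<=` affine_hull S.
Proof. by move=> x Sx M [_]; apply. Qed.

Lemma affine_affine_hull (R : realType) (E : normedModType R) (S : set E) :
  affine_set (affine_hull S).
Proof. by move=> x y l Sx Sy M hM; apply: hM.1; [apply: Sx|apply: Sy]. Qed.

Lemma affine_hull_min (R : realType) (E : normedModType R) (S M : set E) :
  affine_set M -> S `<=` M -> affine_hull S `<=` M.
Proof. by move=> aM SM x; apply. Qed.

(** The points [q + t *: (q - q0)] lie on the line through [q] and [q0], hence in the affine hull,
    and they tend to [q] as [t] tends to 0. *)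
Lemma relint_extend (R : realType) (E : normedModType R) (S : set E) (q q0 : E) :
  relint S q -> S q0 -> exists2 t : R, 0 < t & S (q + t *: (q - q0)).
Proof.
move=> [Sq nq] Sq0; have /nbhs_normP[e /= e0 he] := nq.
have n0 : 0 < `|q - q0| + 1 by rewrite ltr_wpDl.
(* The added 1 keeps the denominator positive when [q = q0]; the displacement has norm below
   [e / 2]. *)
set t := e / 2 / (`|q - q0| + 1); have t0 : 0 < t by rewrite !divr_gt0.
exists t => //; apply: he => /=.
  rewrite opprD addrA subrr sub0r normrN normrZ gtr0_norm//.
  by rewrite mulrAC ltr_pdivrMr//; have := normr_ge0 (q - q0); nra.
have -> : q + t *: (q - q0) = (1 + t) *: q + (1 - (1 + t)) *: q0.
  have -> : 1 - (1 + t) = - t by ring.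
  by rewrite scalerBr scalerDl scale1r scaleNr addrA.
by apply: affine_affine_hull; apply: sub_affine_hull.
Qed.

(* [a = b] encodes the singleton face. *)
Definition cell (R : realType) (B : set R) (a b : R) : Prop :=
  [/\ B a, B b, a <= b & forall y, a < y < b -> ~ B y].

(** The relative interior of [[a, b]], in a form that also serves the singleton [a = b]. *)
Definition incell (R : realType) (a b x : R) : Prop :=
  (a = x /\ x = b) \/ a < x < b.

Lemma incell_le (R : realType) (a b x : R) : incell a b x -> a <= x <= b.
Proof. by move=> [[-> ->]|]; [rewrite lexx|move=> /andP[/ltW-> /ltW->]]. Qed.

Lemma cell_complex (R : realType) (B : set R) (a b : R) :
  cell B a b -> complex B `[a, b]%classic.
Proof.
move=> [Ba Bb]; rewrite le_eqVlt => /predU1P[<- _|ab nB].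
  by rewrite set_itv1; apply: Or32; exists a.
by apply: Or33; exists a, b.
Qed.

Lemma complex_cell (R : realType) (B I : set R) (x : R) :
  complex B I -> I x -> exists a b, cell B a b /\ I = `[a, b]%classic.
Proof.
case=> [->//|[y By ->] _|[a [b [Ba Bb ab nB ->]]] _].
  exists y, y; rewrite set_itv1; split=> //; split=> // z.
  by move=> /andP[yz zy]; move: (lt_trans yz zy); rewrite ltxx.
by exists a, b; split=> //; split=> //; exact: ltW.
Qed.

(** At an endpoint of a nondegenerate interval, prolonging the segment from the opposite endpoint
    would leave the interval. A singleton is its own affine hull. *)
Lemma relint_itv (R : realType) (a b x : R) :
  a <= b -> relint `[a, b]%classic x <-> incell a b x.
Proof.
move=> ab; split.
  move=> rx; have := rx.1; rewrite /= in_itv/= => /andP[ax xb].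
  move: ab; rewrite le_eqVlt => /predU1P[ab|ab].
    left; split; apply/eqP; rewrite eq_le.
      by rewrite ax ab xb.
    by rewrite xb -ab ax.
  right; rewrite !lt_neqAle ax xb !andbT; apply/andP; split; apply/negP => /eqP E.
    have [|t t0] := @relint_extend _ _ _ x b rx.
      by rewrite /= in_itv/= lexx ltW.
    by rewrite /= in_itv /= /GRing.scale/= => /andP[h1 _]; nra.
  have [|t t0] := @relint_extend _ _ _ x a rx.
    by rewrite /= in_itv/= lexx ltW.
  by rewrite /= in_itv /= /GRing.scale/= => /andP[_ h1]; nra.
move=> [[-> <-]|/andP[ax xb]].
  rewrite set_itv1; split => //; near=> y.
  apply: affine_hull_min => // u v l -> ->; rewrite /GRing.scale/=; ring.
split; first by rewrite /= in_itv/= !ltW.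
near=> y => _; rewrite /= in_itv/=; apply/andP; split.
  by near: y; apply: lt_le_nbhsr.
by near: y; apply: lt_le_nbhsl.
Unshelve. all: by end_near. Qed.

(** An endpoint [z] of a nondegenerate interval would be overshot by moving on from [z0] through
    [z]. Each of the three constraints of a face is treated this way. *)
Lemma incell_push (R : realType) (a b z z0 t : R) :
  incell a b z0 -> a <= z <= b -> 0 < t -> a <= z + t * (z - z0) <= b ->
  incell a b z.
Proof.
move=> [[-> <-]|/andP[az0 z0b]] /andP[az zb] t0 /andP[h1 h2].
  by left; split; apply/eqP; rewrite eq_le ?az zb.
right; apply/andP; split; rewrite lt_neqAle ?az ?zb andbT.
  by apply/negP => /eqP E; nra.
by apply/negP => /eqP E; nra.
Qed.

(** For an affine functional [h], a degenerate constraint [a = b] is an equation, which the affine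
    hull inherits; a strict constraint persists near [q] by continuity. *)
Lemma near_affine_hull_itv (R : realType) (E : normedModType R) (S : set E)
    (h : E -> R) (a b : R) (q : E) :
  (forall x y l, h (l *: x + (1 - l) *: y) = l * h x + (1 - l) * h y) ->
  {for q, continuous h} -> (forall x, S x -> a <= h x <= b) ->
  incell a b (h q) -> \forall y \near q, affine_hull S y -> a <= h y <= b.
Proof.
move=> hl hc hS [[aq qb]|/andP[aq qb]].
  suff H : affine_hull S `<=` [set x | a <= h x <= b] by near=> y; exact: H.
  have ab : a = b by rewrite aq.
  apply: affine_hull_min hS; rewrite /affine_set /=.
  rewrite -ab => u v l /le_anti hu /le_anti hv; rewrite hl -hu -hv.
  by apply/andP; split; lra.
have n1 : \forall y \near q, a <= h y := hc _ (lt_le_nbhsr aq).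
have n2 : \forall y \near q, h y <= b := hc _ (lt_le_nbhsl qb).
by near=> y => _; apply/andP; split; near: y.
Unshelve. all: by end_near. Qed.

Definition cface (R : realType) (I J K : R * R) : set (R * R) :=
  face `[I.1, I.2] `[J.1, J.2] `[K.1, K.2].

Definition infaces (R : realType) (I J K p : R * R) : Prop :=
  [/\ incell I.1 I.2 p.1, incell J.1 J.2 p.2 & incell K.1 K.2 (p.1 + p.2)].

Lemma cfaceE (R : realType) (I J K p : R * R) : cface I J K p <->
  [/\ I.1 <= p.1 <= I.2, J.1 <= p.2 <= J.2 & K.1 <= p.1 + p.2 <= K.2].
Proof. by rewrite /cface /face /= !in_itv. Qed.

Lemma infaces_cface (R : realType) (I J K p : R * R) :
  infaces I J K p -> cface I J K p.
Proof. by move=> [? ? ?]; apply/cfaceE; split; apply: incell_le. Qed.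

(** The witness [q0] matters: for [I = J = [0, 1]] and [K = [2, 3]] the face is the point (1, 1),
    its own relative interior, while the strict constraints have no solution. *)
Lemma relint_face (R : realType) (I J K q0 q : R * R) : infaces I J K q0 ->
  relint (cface I J K) q <-> infaces I J K q.
Proof.
move=> q0F; split=> [rq|qF].
  have [t t0 /cfaceE[/= h1 h2 h3]] := relint_extend rq (infaces_cface q0F).
  have /cfaceE[g1 g2 g3] := rq.1.
  case: q0F => i1 i2 i3; split.
  - exact: incell_push i1 g1 t0 h1.
  - exact: incell_push i2 g2 t0 h2.
  - have E : q.1 + q.2 + t * (q.1 + q.2 - (q0.1 + q0.2)) =
        q.1 + t * (q.1 - q0.1) + (q.2 + t * (q.2 - q0.2)) by ring.
    by apply: incell_push i3 g3 t0 _; rewrite E.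
split; first exact: infaces_cface.
case: qF => i1 i2 i3.
have n1 : \forall y \near q, affine_hull (cface I J K) y -> I.1 <= y.1 <= I.2.
  apply: (@near_affine_hull_itv R (R * R)%type _ (fun y => y.1)) => //.
  - exact: cvg_fst.
  - by move=> x /cfaceE[].
have n2 : \forall y \near q, affine_hull (cface I J K) y -> J.1 <= y.2 <= J.2.
  apply: (@near_affine_hull_itv R (R * R)%type _ (fun y => y.2)) => //.
  - exact: cvg_snd.
  - by move=> x /cfaceE[].
have n3 : \forall y \near q, affine_hull (cface I J K) y ->
    K.1 <= y.1 + y.2 <= K.2.
  apply: (@near_affine_hull_itv R (R * R)%type _ (fun y => y.1 + y.2)) => //.
  - by move=> x y l /=; rewrite /GRing.scale/=; ring.
  - by apply: cvgD; [exact: cvg_fst|exact: cvg_snd].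
  - by move=> x /cfaceE[].
near=> y => hy; apply/cfaceE; split.
- exact: (near n1 y).
- exact: (near n2 y).
- exact: (near n3 y).
Unshelve. all: by end_near. Qed.

(** * Affine pieces of a piecewise linear function and of its Delta on faces *)

Definition lin (R : realType) (k : R * R) (x : R) : R := k.1 * x + k.2.

Definition pl_coef (R : realType) (B : set R) (theta : R -> R)
    (k : R * R -> R * R) : Prop :=
  forall I, cell B I.1 I.2 -> forall x, incell I.1 I.2 x -> theta x = lin (k I) x.

Lemma pl_coef_exists (R : realType) (B : set R) (theta : R -> R) :
  piecewise_linear (complex B) theta -> exists k, pl_coef B theta k.
Proof.
move=> pl.
suff /choice[k hk] : forall I : R * R, exists c : R * R, cell B I.1 I.2 ->
    forall x, incell I.1 I.2 x -> theta x = lin c x.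
  by exists k => I; exact: hk.
move=> I; have [cI|] := pselect (cell B I.1 I.2); last by exists (0, 0).
have [a [b hab]] := pl _ (cell_complex cI).
by exists (a, b) => _ x xI; apply: hab; apply/relint_itv => //; case: cI.
Qed.

(** The affine function on the whole plane that agrees with [delta theta] on the relative interior
    of the face; on the rest of the closed face it gives the limits Delta theta_F. *)
Definition facelin (R : realType) (k : R * R -> R * R) (I J K p : R * R) : R :=
  lin (k I) p.1 + lin (k J) p.2 - lin (k K) (p.1 + p.2).

Lemma delta_facelin (R : realType) (B : set R) (theta : R -> R) k
    (I J K p : R * R) : pl_coef B theta k ->
  cell B I.1 I.2 -> cell B J.1 J.2 -> cell B K.1 K.2 -> infaces I J K p ->
  delta theta p.1 p.2 = facelin k I J K p.
Proof. by move=> kP cI cJ cK [i1 i2 i3]; rewrite /delta (kP I)// (kP J)// (kP K). Qed.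

Lemma facelin_segment (R : realType) (k : R * R -> R * R)
    (I J K p q : R * R) (t : R) :
  facelin k I J K (p + t *: (q - p)) =
  (1 - t) * facelin k I J K p + t * facelin k I J K q.
Proof. by rewrite /facelin /lin /= /GRing.scale/=; ring. Qed.

Lemma incell_segment (R : realType) (a b z z0 t : R) :
  incell a b z0 -> a <= z <= b -> 0 < t <= 1 -> incell a b (z + t * (z0 - z)).
Proof.
move=> [[<- <-]|/andP[az0 z0b]] /andP[az zb] /andP[t0 t1].
  have -> : z = a by apply/eqP; rewrite eq_le zb az.
  by rewrite subrr mulr0 addr0; left.
by right; apply/andP; split; nra.
Qed.

Lemma infaces_segment (R : realType) (I J K p q : R * R) (t : R) :
  infaces I J K q -> cface I J K p -> 0 < t <= 1 ->
  infaces I J K (p + t *: (q - p)).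
Proof.
move=> [i1 i2 i3] /cfaceE[h1 h2 h3] t01; split.
- exact: incell_segment.
- exact: incell_segment.
- have -> : (p + t *: (q - p)).1 + (p + t *: (q - p)).2 =
      p.1 + p.2 + t * (q.1 + q.2 - (p.1 + p.2)).
    by rewrite /= /GRing.scale/=; ring.
  exact: incell_segment.
Qed.

Lemma nbhs_segment (R : realType) (E : normedModType R) (p q : E) (A : set E) :
  nbhs p A -> exists2 t : R, 0 < t <= 1 & A (p + t *: (q - p)).
Proof.
move=> /nbhs_normP[e /= e0 he].
(* This choice ensures both [t <= 1] and a displacement of norm below [e], also when [q = p]. *)
set t := e / (`|q - p| + e).
have d0 : 0 < `|q - p| + e by rewrite ltr_wpDl.
have t01 : 0 < t <= 1.
  by rewrite divr_gt0//= ler_pdivrMr// mul1r lerDr.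
exists t => //; apply: he => /=.
rewrite opprD addrA subrr sub0r normrN normrZ gtr0_norm; last by case/andP: t01.
by rewrite /t mulrAC ltr_pdivrMr//; have := normr_ge0 (q - p); nra.
Qed.

(** A segment from a point of the face to a relative interior point is relatively interior except
    possibly at its start. This makes the filter defining Delta theta_F proper, so that its limit is
    unique. *)
Lemma closure_relint_face (R : realType) (I J K p q : R * R) :
  infaces I J K q -> cface I J K p -> closure (relint (cface I J K)) p.
Proof.
move=> qF pF A /(@nbhs_segment R (R * R)%type _ q)[t t01 At].
exists (p + t *: (q - p)); split => //.
by apply/(relint_face _ qF); apply: infaces_segment.
Qed.

Lemma delta_face_lin (R : realType) (B : set R) (theta : R -> R) k
    (I J K p q : R * R) : pl_coef B theta k ->
  cell B I.1 I.2 -> cell B J.1 J.2 -> cell B K.1 K.2 -> infaces I J K q ->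
  delta_face_eq theta (cface I J K) p (facelin k I J K p).
Proof.
move=> kP cI cJ cK qF; rewrite /delta_face_eq.
have c : facelin k I J K x @[x --> within (relint (cface I J K)) (nbhs p)] -->
    facelin k I J K p.
  apply: cvg_within_filter.
  by apply: cvgB; [apply: cvgD|]; apply: cvgD; try exact: cvg_cst;
    apply: cvgM; try exact: cvg_cst; try exact: cvg_fst; try exact: cvg_snd;
    apply: cvgD; [exact: cvg_fst|exact: cvg_snd].
apply: cvg_trans c; apply: near_eq_cvg; rewrite near_withinE; near=> x => rx.
by apply/esym; apply: (delta_facelin kP) => //; apply/(relint_face _ qF).
Unshelve. all: by end_near. Qed.

Lemma delta_face_lin_unique (R : realType) (B : set R) (theta : R -> R) k
    (I J K p q : R * R) l : pl_coef B theta k ->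
  cell B I.1 I.2 -> cell B J.1 J.2 -> cell B K.1 K.2 -> infaces I J K q ->
  cface I J K p -> delta_face_eq theta (cface I J K) p l ->
  l = facelin k I J K p.
Proof.
move=> kP cI cJ cK qF pF dl.
have PF : ProperFilter (within (relint (cface I J K)) (nbhs p)).
  by apply: within_nbhs_proper; exact: closure_relint_face qF pF.
exact: (cvg_unique _ dl (delta_face_lin kP cI cJ cK qF)).
Qed.

(** * Vertices and breakpoint grids *)

(** Both coordinates are shifted by the same [s], whose sign is chosen against that of the rate
    [al], until the first of the two reaches the end of its interval. *)
Lemma slide (R : realType) (a b c d x y al : R) :
  a <= x <= b -> c <= y <= d ->
  exists s, [/\ a <= x + s <= b, c <= y + s <= d, al * s <= 0 &
    [\/ x + s = a, x + s = b, y + s = c | y + s = d]].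
Proof.
move=> /andP[ax xb] /andP[cy yd]; have [al0|al0] := leP al 0.
  have [h|h] := leP (b - x) (d - y).
    exists (b - x); split; last by apply: Or42; ring.
    - by apply/andP; split; lra.
    - by apply/andP; split; lra.
    - by rewrite mulr_le0_ge0// subr_ge0.
  exists (d - y); split; last by apply: Or44; ring.
  - by apply/andP; split; lra.
  - by apply/andP; split; lra.
  - by rewrite mulr_le0_ge0// subr_ge0.
have [h|h] := leP (a - x) (c - y).
  exists (c - y); split; last by apply: Or43; ring.
  - by apply/andP; split; lra.
  - by apply/andP; split; lra.
  - by rewrite mulr_ge0_le0 ?subr_le0// ltW.
exists (a - x); split; last by apply: Or41; ring.
- by apply/andP; split; lra.
- by apply/andP; split; lra.
- by rewrite mulr_ge0_le0 ?subr_le0// ltW.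
Qed.

Definition two_breakpoints (R : realType) (B : set R) (p : R * R) : Prop :=
  [\/ B p.1 /\ B p.2, B p.1 /\ B (p.1 + p.2) | B p.2 /\ B (p.1 + p.2)].

(* Slide along an edge direction until a second breakpoint is hit; of the two
   orientations one does not increase the affine function. *)
Lemma vertex_descent (R : realType) (B : set R) (I J K p : R * R) (al be : R) :
  cell B I.1 I.2 -> cell B J.1 J.2 -> cell B K.1 K.2 -> cface I J K p ->
  exists p', [/\ cface I J K p', two_breakpoints B p' &
    al * p'.1 + be * p'.2 <= al * p.1 + be * p.2].
Proof.
move=> [I1 I2 _ _] [J1 J2 _ _] [K1 K2 _ _] /cfaceE[h1 h2 h3].
(* First slide along (1, 0), which keeps [p.2] and shifts [p.1] and [p.1 + p.2] together. *)
have [s [a1 a3 as0 hs]] := slide al h1 h3.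
set u := p.1 + s in a1 hs; set w := p.1 + p.2 + s in a3 hs.
have [Bu|Bw] : B u \/ B w by case: hs => ->; [left|left|right|right].
  have [r [b2 b3 br hr]] := slide be h2 a3.
  exists (u, p.2 + r).
  have E : u + (p.2 + r) = w + r by rewrite /u /w; ring.
  split.
  - by apply/cfaceE; split => //=; rewrite E.
  - by case: hr => hr; [apply: Or31|apply: Or31|apply: Or32|apply: Or32];
      rewrite /= ?E hr.
  - by rewrite /u /=; nra.
(* With the sum [w] kept, the coordinates move in opposite directions. Negating the second one makes
   them move together, and the rate along (1, -1) is [al - be]. *)
have h2' : - J.2 <= - p.2 <= - J.1 by rewrite !lerN2 andbC.
have [r [b1 b2 br hr]] := slide (al - be) a1 h2'.
exists (u + r, p.2 - r).
have E : u + r + (p.2 - r) = w by rewrite /u /w; ring.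
split.
- apply/cfaceE; split => //=; last by rewrite E.
  by apply/andP; move/andP: b2 => [? ?]; split; lra.
- have E2 : - p.2 + r = - (p.2 - r) by ring.
  rewrite E2 in hr; rewrite /two_breakpoints /= E.
  case: hr => [->|->|/oppr_inj ->|/oppr_inj ->].
  + exact: Or32.
  + exact: Or32.
  + exact: Or33.
  + exact: Or33.
- by rewrite /u /=; nra.
Qed.

(** What is needed of both [B] and the refined breakpoints; the latter are not given as a sorted
    list. The window reaches up to 2 because it must contain [x + y] for [x] and [y] in [0, 1). *)
Record grid (R : realType) (B : set R) : Prop := Grid {
  grid0 : B 0;
  gridD : forall x (z : int), B x -> B (x + z%:~R);
  grid_fin : finite_set (B `&` `[0, 2]) }.

Lemma exists_max_le (R : realType) (s : seq R) (x : R) :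
  (exists2 y, y \in s & y <= x) ->
  exists a, [/\ a \in s, a <= x & forall y, y \in s -> y <= x -> y <= a].
Proof.
elim: s => [[y]//|z s IH] [y ys yx].
have [[a [as_ ax amax]]|nex] := pselect (exists a, [/\ a \in s, a <= x &
    forall y, y \in s -> y <= x -> y <= a]).
  have [zx|xz] := leP z x; last first.
    exists a; split=> //; first by rewrite inE as_ orbT.
    by move=> w; rewrite inE => /predU1P[->|/amax//]; rewrite leNgt xz.
  have [za|az] := leP z a.
    exists a; split=> //; first by rewrite inE as_ orbT.
    by move=> w; rewrite inE => /predU1P[->|/amax].
  exists z; split=> //; first by rewrite inE eqxx.
  move=> w; rewrite inE => /predU1P[->//|/amax h] /h wa.
  exact: le_trans (ltW az).
have no : forall w, w \in s -> ~ w <= x.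
  by move=> w ws wx; apply: nex; apply: IH; exists w.
move: ys; rewrite inE => /predU1P[yz|/no//]; exists z; split.
- by rewrite inE eqxx.
- by rewrite -yz.
- by move=> w; rewrite inE => /predU1P[->//|/no].
Qed.

Lemma exists_min_ge (R : realType) (s : seq R) (x : R) :
  (exists2 y, y \in s & x <= y) ->
  exists a, [/\ a \in s, x <= a & forall y, y \in s -> x <= y -> a <= y].
Proof.
move=> [y ys xy].
have [|a [as_ ax amax]] := @exists_max_le R [seq - z | z <- s] (- x).
  by exists (- y); rewrite ?lerN2// mem_map//; exact: oppr_inj.
move/mapP: as_ => [b bs E]; subst a; exists b; split => //.
  by rewrite -lerN2.
move=> w ws xw; rewrite -lerN2; apply: amax; rewrite ?lerN2// mem_map//; exact: oppr_inj.
Qed.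

Lemma cell_exists (R : realType) (B : set R) (x : R) : grid B ->
  exists I : R * R, cell B I.1 I.2 /\ incell I.1 I.2 x.
Proof.
move=> gB; have [B0 BD /finite_seqP[s sE]] := gB.
have inB y : y \in s <-> B y /\ 0 <= y <= 2.
  by have /= := congr1 (fun S => S y) sE; rewrite in_itv/= => <-.
suff H : forall x, 0 <= x < 1 -> exists I : R * R, cell B I.1 I.2 /\
    incell I.1 I.2 x.
  have /andP[f1 f2] := floor_itv x; set n := Num.floor x in f1 f2.
  have [|[a b] /= [[Ba Bb ab nB] xI]] := H (x - n%:~R).
    by rewrite subr_ge0 f1 ltrBlDr -(intrD _ 1) addrC.
  exists (a + n%:~R, b + n%:~R); split; [split|] => /=.
  - exact: BD.
  - exact: BD.
  - by rewrite lerD2r.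
  - move=> y /andP[ay yb] By; apply: (nB (y - n%:~R)).
      by apply/andP; split; lra.
    by rewrite -mulrNz; exact: BD.
  - by case: xI => [[-> <-]|/andP[h1 h2]]; [left; split; ring|
      right; apply/andP; split; lra].
move=> {}x /andP[x0 x1].
have B1 : B 1 by have := BD 0 1 B0; rewrite add0r.
have [Bx|nBx] := pselect (B x).
  exists (x, x); split; last by left.
  by split=> //= y /andP[h1 h2]; move: (lt_trans h1 h2); rewrite ltxx.
have [|a [/inB[Ba /andP[a0 a2]] ax amax]] := @exists_max_le R s x.
  by exists 0 => //; apply/inB; rewrite lexx ler0n.
have [|b [/inB[Bb /andP[b0 b2]] xb bmin]] := @exists_min_ge R s x.
  by exists 1; [apply/inB; rewrite ler01 ler1n|exact: ltW].
exists (a, b) => /=; split.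
  split=> //=; first exact: le_trans xb.
  move=> y /andP[ay yb] By.
  have ys : y \in s by apply/inB; split=> //; apply/andP; split; lra.
  have [yx|xy] := leP y x.
    by have := amax y ys yx; rewrite leNgt ay.
  by have := bmin y ys (ltW xy); rewrite leNgt yb.
right; rewrite !lt_neqAle ax xb !andbT; apply/andP; split.
  by apply: contra_notN nBx => /eqP <-.
by apply: contra_notN nBx => /eqP ->.
Qed.

(** Since 0 and 2 are breakpoints, neither lies strictly inside a cell, so a cell whose relative
    interior meets [0, 2] stays within it. *)
Lemma cell_sub02 (R : realType) (B : set R) (a b x : R) : B 0 -> B 2 ->
  cell B a b -> incell a b x -> 0 <= x <= 2 ->
  [/\ (B `&` `[0, 2]) a, (B `&` `[0, 2]) b & forall y, a <= y <= b -> 0 <= y <= 2].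
Proof.
move=> B0 B2 [Ba Bb ab nB] xI /andP[x0 x2].
have /andP[a0 b2] : (0 <= a) && (b <= 2).
  case: xI => [[-> <-]|/andP[ax xb]]; first by rewrite x0 x2.
  apply/andP; split; rewrite leNgt; apply/negP => h.
    by apply: (nB 0) => //; rewrite h (le_lt_trans x0).
  by apply: (nB 2) => //; rewrite h (lt_le_trans ax).
split; try by split => //=; rewrite in_itv/=; apply/andP; split; lra.
by move=> y /andP[h1 h2]; apply/andP; split; lra.
Qed.

Lemma finite_uniform_bound (R : realType) (T : eqType) (S : set T)
    (P : T -> R -> Prop) : finite_set S ->
  (forall z M M', M <= M' -> P z M -> P z M') ->
  (forall z, S z -> exists M, P z M) ->
  exists2 M, 0 <= M & forall z, S z -> P z M.
Proof.
move=> /finite_seqP[s ->] mono; elim: s => [|w s IH] ex; first by exists 0.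
have [|M M0 hM] := IH; first by move=> z zs; apply: ex; rewrite /= inE [z \in s]zs orbT.
have [|N hN] := ex w; first by rewrite /= inE eqxx.
exists (Num.max M N); first by rewrite le_max M0.
move=> z; rewrite /= inE => /predU1P[->|zs].
  by apply: mono hN; rewrite le_max lexx orbT.
by apply: mono (hM _ zs); rewrite le_max lexx.
Qed.

(** * Domination of Delta theta by Delta pi *)

(** Nonnegativity on the relative interior passes to the closed face along a segment ending at an
    interior point. *)
Lemma facelin_ge0 (R : realType) (B : set R) (theta : R -> R) k
    (I J K p q : R * R) : pl_coef B theta k ->
  (forall x y, 0 <= delta theta x y) ->
  cell B I.1 I.2 -> cell B J.1 J.2 -> cell B K.1 K.2 -> infaces I J K q ->
  cface I J K p -> 0 <= facelin k I J K p.
Proof.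
move=> kP d0 cI cJ cK qF pF; rewrite leNgt; apply/negP => Lp.
have H t : 0 < t <= 1 ->
    0 <= (1 - t) * facelin k I J K p + t * facelin k I J K q.
  move=> t01; rewrite -facelin_segment -(delta_facelin kP)//.
  exact: infaces_segment.
move: H Lp; set a := facelin _ _ _ _ _; set b := facelin _ _ _ _ _ => H Lp.
have b0 : 0 <= b by have := H 1; rewrite ltr01 lexx subrr mul0r add0r mul1r; apply.
have ba : 0 < b - a by lra.
(* With this parameter the affine function takes the value [a / 2 < 0] strictly inside the
   segment. *)
have E : - a / 2 / (b - a) * (b - a) = - a / 2 by rewrite divfK// gt_eqF.
have t0 : 0 < - a / 2 / (b - a) by rewrite !divr_gt0//; lra.
have t1 : - a / 2 / (b - a) <= 1 by rewrite ler_pdivrMr//; lra.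
by have := H (- a / 2 / (b - a)); rewrite t0 t1 => /(_ isT); nra.
Qed.

Lemma facelin_combE (R : realType) (k k' : R * R -> R * R) (M : R)
    (I J K : R * R) : exists al be ga, forall p,
  M * facelin k I J K p - facelin k' I J K p = al * p.1 + be * p.2 + ga.
Proof.
exists (M * ((k I).1 - (k K).1) - ((k' I).1 - (k' K).1)).
exists (M * ((k J).1 - (k K).1) - ((k' J).1 - (k' K).1)).
exists (M * ((k I).2 + (k J).2 - (k K).2) - ((k' I).2 + (k' J).2 - (k' K).2)).
by move=> p; rewrite /facelin /lin; ring.
Qed.

Lemma facelin_vertex_le (R : realType) (B : set R) (k k' : R * R -> R * R)
    (M : R) (I J K q : R * R) :
  cell B I.1 I.2 -> cell B J.1 J.2 -> cell B K.1 K.2 -> cface I J K q ->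
  (forall p, cface I J K p -> two_breakpoints B p ->
    facelin k' I J K p <= M * facelin k I J K p) ->
  facelin k' I J K q <= M * facelin k I J K q.
Proof.
move=> cI cJ cK qF H; have [al [be [ga E]]] := facelin_combE k k' M I J K.
have [p [pF p2 le]] := vertex_descent al be cI cJ cK qF.
rewrite -subr_ge0 E; have := H p pF p2; rewrite -subr_ge0 E.
by move=> /le_trans; apply; rewrite lerD2r.
Qed.

Lemma floor_frac (R : realType) (x : R) : 0 <= x - (Num.floor x)%:~R < 1.
Proof.
have /andP[f1 f2] := floor_itv x.
by rewrite subr_ge0 f1 ltrBlDr -(intrD _ 1) addrC.
Qed.

Lemma delta_periodic (R : realType) (theta : R -> R) :
  (forall x (z : int), theta (x + z%:~R) = theta x) ->
  forall x y (m n : int), delta theta (x + m%:~R) (y + n%:~R) = delta theta x y.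
Proof.
move=> per x y m n; rewrite /delta !per.
have -> : x + m%:~R + (y + n%:~R) = x + y + (m + n)%:~R by rewrite intrD; ring.
by rewrite per.
Qed.

Lemma delta_bound (R : realType) (B : set R) (pi theta : R -> R) kp kt :
  grid B -> pl_coef B pi kp -> pl_coef B theta kt ->
  (forall x (z : int), pi (x + z%:~R) = pi x) ->
  (forall x (z : int), theta (x + z%:~R) = theta x) ->
  (forall x y, 0 <= delta pi x y) ->
  (forall I J K p q, cell B I.1 I.2 -> cell B J.1 J.2 -> cell B K.1 K.2 ->
    infaces I J K q -> cface I J K p -> two_breakpoints B p ->
    facelin kp I J K p = 0 -> facelin kt I J K p = 0) ->
  exists2 M, 0 <= M & forall x y, `|delta theta x y| <= M * delta pi x y.
Proof.
move=> gB kpP ktP perp pert d0 hyp; have [B0 BD finB] := gB.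
have B2 : B 2 by have := BD 0 2 B0; rewrite add0r.
set S := B `&` `[0, 2].
(* A vertex has two breakpoints among [x], [y], [x + y]; a coordinate that is not one of the two is
   a difference of them. *)
set V := S `|` [set x - y | x in S & y in S].
set TT := ((S `*` S) `*` (S `*` S)) `*` ((S `*` S) `*` (V `*` V)).
have finT : finite_set TT.
  have finV : finite_set V by rewrite finite_setU; split=> //; exact: finite_image2.
  by do !apply: finite_setX.
pose P (z : ((R * R) * (R * R)) * ((R * R) * (R * R))) (M : R) :=
  let I := z.1.1 in let J := z.1.2 in let K := z.2.1 in let p := z.2.2 in
  cell B I.1 I.2 -> cell B J.1 J.2 -> cell B K.1 K.2 ->
  (exists q, infaces I J K q) -> cface I J K p -> two_breakpoints B p ->
  `|facelin kt I J K p| <= M * facelin kp I J K p.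
have [||M M0 hM] := @finite_uniform_bound R _ TT P finT.
(* Monotonicity in [M] rests on [facelin kp] being nonnegative, for which [P] carries a relative
   interior point. *)
- rewrite /P /= => z M M' MM' h cI cJ cK qF pF p2.
  apply: le_trans (h cI cJ cK qF pF p2) _.
  apply: ler_wpM2r => //; have [q qF'] := qF.
  exact: (facelin_ge0 kpP d0 cI cJ cK qF' pF).
- move=> [[I J] [K p]] _; rewrite /P /=.
  (* Where Delta pi_F vanishes, so does Delta theta_F and the bound 0 works; elsewhere their ratio
     is a bound. *)
  have [L0|L0] := eqVneq (facelin kp I J K p) 0.
    by exists 0 => cI cJ cK [q qF] pF p2; rewrite (hyp _ _ _ _ q)// normr0 mul0r.
  exists (`|facelin kt I J K p| / facelin kp I J K p) => *.
  by rewrite divfK.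
exists M => // x y.
wlog [x01 y01] : x y / 0 <= x < 1 /\ 0 <= y < 1.
  move=> H; rewrite -(delta_periodic pert x y (- Num.floor x) (- Num.floor y)).
  rewrite -(delta_periodic perp x y (- Num.floor x) (- Num.floor y)).
  by apply: H; rewrite !mulrNz; split; exact: floor_frac.
have x02 : 0 <= x <= 2 by move/andP: x01 => [? ?]; apply/andP; split; lra.
have y02 : 0 <= y <= 2 by move/andP: y01 => [? ?]; apply/andP; split; lra.
have xy02 : 0 <= x + y <= 2.
  by move/andP: x01 => [? ?]; move/andP: y01 => [? ?]; apply/andP; split; lra.
have [I [cI iI]] := cell_exists x gB.
have [J [cJ iJ]] := cell_exists y gB.
have [K [cK iK]] := cell_exists (x + y) gB.
have qF : infaces I J K (x, y) by [].
have [I1 I2 I02] := cell_sub02 B0 B2 cI iI x02.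
have [J1 J2 J02] := cell_sub02 B0 B2 cJ iJ y02.
have [K1 K2 K02] := cell_sub02 B0 B2 cK iK xy02.
rewrite (delta_facelin ktP cI cJ cK qF) (delta_facelin kpP cI cJ cK qF).
have vert p : cface I J K p -> two_breakpoints B p ->
    `|facelin kt I J K p| <= M * facelin kp I J K p.
  move=> pF p2; apply: (hM ((I, J), (K, p))) => //=; last by exists (x, y).
  have /cfaceE[p1I p2J p3K] := pF.
  have S1 : B p.1 -> S p.1 by split => //; rewrite /= in_itv/=; exact: I02.
  have S2 : B p.2 -> S p.2 by split => //; rewrite /= in_itv/=; exact: J02.
  have S3 : B (p.1 + p.2) -> S (p.1 + p.2).
    by split => //; rewrite /= in_itv/=; exact: K02.
  do !split => //=; case: p2 => [[/S1 ? /S2 ?]|[/S1 ? /S3 ?]|[/S2 ? /S3 ?]];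
    try (by left); right.
  - by exists (p.1 + p.2) => //; exists p.2 => //; ring.
  - by exists (p.1 + p.2) => //; exists p.1 => //; ring.
rewrite ler_norml; apply/andP; split; last first.
  apply: (facelin_vertex_le cI cJ cK (infaces_cface qF)) => p pF p2.
  by have := vert p pF p2; rewrite ler_norml => /andP[].
(* Changing the signs of the coefficients reduces the lower bound to the upper one. *)
pose kn I := (- (kt I).1, - (kt I).2).
have knE p : facelin kn I J K p = - facelin kt I J K p.
  by rewrite /facelin /lin /=; ring.
rewrite lerNl -knE; apply: (facelin_vertex_le cI cJ cK (infaces_cface qF)) => p pF p2.
by rewrite knE lerNl; have := vert p pF p2; rewrite ler_norml => /andP[].
Qed.

(** Modulo Z there are finitely many cells, and for [x] in [0, 1) an affine function is bounded by
    the absolute values of its two coefficients. *)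
Lemma grid_pl_bounded (R : realType) (B : set R) (theta : R -> R) k :
  grid B -> pl_coef B theta k ->
  (forall x (z : int), theta (x + z%:~R) = theta x) ->
  exists M, forall x, `|theta x| <= M.
Proof.
move=> gB kP per; have [B0 BD finB] := gB.
have B2 : B 2 by have := BD 0 2 B0; rewrite add0r.
set S := B `&` `[0, 2].
pose P (I : R * R) (M : R) := cell B I.1 I.2 ->
  forall x, 0 <= x < 1 -> incell I.1 I.2 x -> `|theta x| <= M.
have [||| M M0 hM] := @finite_uniform_bound R _ (S `*` S) P.
- exact: finite_setX.
- by rewrite /P => z M M' MM' h cI x x01 xI; apply: le_trans (h cI x x01 xI) MM'.
- move=> I _; exists (`|(k I).1| + `|(k I).2|) => cI x /andP[x0 x1] xI.
  rewrite (kP I)// /lin; apply: le_trans (ler_normD _ _) _; rewrite lerD2r normrM.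
  by rewrite ler_piMr// ger0_norm// ltW.
exists M => x; rewrite -(per x (- Num.floor x)) mulrNz.
have x01 := floor_frac x; set x' := x - _ in x01 *.
have [I [cI iI]] := cell_exists x' gB.
have x02 : 0 <= x' <= 2 by move/andP: x01 => [? ?]; apply/andP; split; lra.
have [I1 I2 I02] := cell_sub02 B0 B2 cI iI x02.
exact: (hM I).
Qed.

(** * Small perturbations of a minimal valid function *)

Lemma subadditive_bounded_ge0 (R : realType) (phi : R -> R) (M : R) :
  (forall x y, 0 <= delta phi x y) -> phi 0 = 0 ->
  (forall x, `|phi x| <= M) -> forall x, 0 <= phi x.
Proof.
move=> sub phi0 bd x; rewrite leNgt; apply/negP => neg.
(* A negative value at [x] would force the values at the multiples of [x] to decrease at least
   linearly, against the bound. *)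
have H n : phi (x *+ n) <= phi x *+ n.
  elim: n => [|n IH]; first by rewrite !mulr0n phi0.
  rewrite !mulrSr; have := sub (x *+ n) x; rewrite /delta; lra.
have := archi_boundP (_ : 0 <= (M + 1) / - phi x).
have M0 : 0 <= M by apply: le_trans (bd 0).
set n := Num.bound _; rewrite divr_ge0 ?oppr_ge0 ?(ltW neg) ?addr_ge0// => /(_ isT).
rewrite ltr_pdivrMr ?oppr_gt0// => h.
have := H n; rewrite -[phi x *+ n]mulr_natl; have := bd (x *+ n).
rewrite ler_norml => /andP[h1 _]; nra.
Qed.

Lemma deltaD_ge0 (R : realType) (pi theta : R -> R) (M e : R) :
  (forall x y, `|delta theta x y| <= M * delta pi x y) ->
  (forall x y, 0 <= delta pi x y) -> `|e| * M <= 1 ->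
  forall x y, 0 <= delta (fun x => pi x + e * theta x) x y.
Proof.
move=> bd d0 eM x y.
have -> : delta (fun x => pi x + e * theta x) x y =
    delta pi x y + e * delta theta x y by rewrite /delta; ring.
have : `|e * delta theta x y| <= delta pi x y.
  rewrite normrM; apply: le_trans (ler_wpM2l (normr_ge0 e) (bd x y)) _.
  by rewrite mulrA -[leRHS]mul1r ler_wpM2r.
by rewrite ler_norml => /andP[]; lra.
Qed.

(** The sign of [e] is free, so that one statement yields both perturbed functions. *)
Lemma minimal_valid_perturb (R : realType) (f : R) (pi theta : R -> R)
    (M K e : R) : minimal_valid f pi ->
  (forall x, `|pi x| <= K) -> (forall x, `|theta x| <= K) ->
  (forall x (z : int), theta (x + z%:~R) = theta x) ->
  theta 0 = 0 -> theta f = 0 ->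
  (forall x y, `|delta theta x y| <= M * delta pi x y) -> `|e| * M <= 1 ->
  minimal_valid f (fun x => pi x + e * theta x).
Proof.
move=> [pi0 piper pi00 pif pisub pisym] bp bt per t0 tf bd eM.
have sub := deltaD_ge0 bd pisub eM.
have at0 : pi 0 + e * theta 0 = 0 by rewrite t0 mulr0 addr0.
split => //.
- apply: (@subadditive_bounded_ge0 _ _ (K + `|e| * K)) => // x.
  apply: le_trans (ler_normD _ _) _; rewrite lerD// normrM.
  by rewrite ler_wpM2l.
- by move=> x z; rewrite piper per.
- by rewrite tf mulr0 addr0.
(* Domination carries the identity [delta pi x (f - x) = 0] over to [theta], which preserves
   symmetry. *)
- move=> x; have := bd x (f - x); rewrite pisym mulr0 normr_le0 => /eqP h.
  have := pisym x; move: h; rewrite /delta => h1 h2.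
  have -> : pi x + e * theta x + (pi (f - x) + e * theta (f - x)) -
    (pi (x + (f - x)) + e * theta (x + (f - x))) =
    (pi x + pi (f - x) - pi (x + (f - x))) +
    e * (theta x + theta (f - x) - theta (x + (f - x))) by ring.
  by rewrite h1 h2 mulr0 addr0.
Qed.

(** Symmetry reads [pi x + pi (f - x) = 1], where both terms are nonnegative. *)
Lemma minimal_valid_le1 (R : realType) (f : R) (pi : R -> R) x :
  minimal_valid f pi -> `|pi x| <= 1.
Proof.
move=> [pi0 _ _ pif _ pisym]; rewrite ger0_norm//; have := pisym x.
have E : x + (f - x) = f by ring.
by rewrite /delta E pif; have := pi0 (f - x); lra.
Qed.

(** * Finiteness of the refined breakpoints *)

Lemma complexP (R : realType) (B : set R) (theta : R -> R) :
  (forall a b, cell B a b -> a < b ->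
    exists al be, forall x, a < x < b -> theta x = al * x + be) ->
  piecewise_linear (complex B) theta.
Proof.
move=> H I cI; have [[x Ix]|nI] := pselect (exists x, I x); last first.
  by exists 0, 0 => x [Ix _]; case: nI; exists x.
have [a [b [cab ->]]] := complex_cell cI Ix.
have [_ _ ab _] := cab; have [E|] := eqVneq a b.
  exists 0, (theta b) => y /relint_itv -/(_ ab)[[_ ->]|].
    by rewrite mul0r add0r.
  by rewrite E => /andP[h1 h2]; move: (lt_trans h1 h2); rewrite ltxx.
move=> nab; have ltab : a < b by rewrite lt_neqAle nab.
have [al [be h]] := H a b cab ltab; exists al, be => y /relint_itv -/(_ ab).
case=> [[ay yb]|]; last exact: h.
by move: ltab; rewrite ay yb ltxx.
Qed.

(** The cell of [B] around the midpoint of a cell of [B'] contains the whole of it, because its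
    endpoints also belong to [B']. *)
Lemma piecewise_linear_sub (R : realType) (B B' : set R) (theta : R -> R) :
  grid B -> B `<=` B' -> piecewise_linear (complex B) theta ->
  piecewise_linear (complex B') theta.
Proof.
move=> gB BB' /pl_coef_exists[k kP]; apply: complexP => a b [Ba Bb _ nB] ab.
have m1 : a < (a + b) / 2 by lra.
have m2 : (a + b) / 2 < b by lra.
have [I [cI iI]] := cell_exists ((a + b) / 2) gB.
have [I1 I2 _ _] := cI.
case: iI => [[E _]|/andP[h1 h2]].
  by case: (nB I.1); [rewrite E m1 m2|exact: BB'].
have Ia : I.1 <= a.
  rewrite leNgt; apply/negP => h; apply: (nB I.1); last exact: BB'.
  by rewrite h (lt_trans h1).
have bI : b <= I.2.
  rewrite leNgt; apply/negP => h; apply: (nB I.2); last exact: BB'.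
  by rewrite h andbT (lt_trans m1).
exists (k I).1, (k I).2 => x /andP[ax xb]; apply: kP => //; right.
by apply/andP; split; lra.
Qed.

(** Each element of the window is the fractional part of some [q] plus 0, 1 or 2. *)
Lemma finite_add_Z (R : realType) (Q : set R) :
  finite_set Q -> finite_set (add_Z Q `&` `[0, 2]).
Proof.
move=> finQ.
have fin : finite_set [set q - (Num.floor q)%:~R + n%:R | q in Q & n in `I_3].
  by apply: finite_image2.
apply: sub_finite_set fin => x [[q Qq [z ->]]] /=; rewrite in_itv/= => /andP[h0 h2].
have /andP[f0 f1] := floor_frac q.
have E : q + z%:~R = q - (Num.floor q)%:~R + (Num.floor q + z)%:~R.
  by rewrite intrD; ring.
move: (Num.floor q + z) E => m E; rewrite E in h0 h2 *.
have m0 : (0 <= m)%R.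
  rewrite -ltzD1 -(ltr_int R) intrD; lra.
have m3 : (m < 3)%R.
  rewrite -(ltr_int R); lra.
case: m {E h0 h2} m0 m3 => // n _ n3; exists q => //; exists n => //.
Qed.

Lemma add_Z_grid (R : realType) (Q : set R) :
  finite_set Q -> Q 0 -> grid (add_Z Q).
Proof.
move=> finQ Q0; split; last exact: finite_add_Z.
  by exists 0 => //; exists 0; rewrite addr0.
by move=> x z [q Qq [n ->]]; exists q => //; exists (n + z); rewrite intrD addrA.
Qed.

Lemma breakpoint_setE (R : realType) (s : seq R) : sorted <%R (0 :: rcons s 1) ->
  forall q, q \in 0 :: s -> 0 <= q < 1.
Proof.
rewrite -rcons_cons (sorted_pairwise lt_trans) pairwise_rcons.
move=> /andP[/allP h1 /= /andP[/allP h2 _]] q qs; rewrite (h1 _ qs) andbT.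
by move: qs; rewrite inE => /predU1P[->//|/h2/ltW].
Qed.

Lemma breakpoint_set_grid (R : realType) (B : set R) :
  breakpoint_set B -> grid B.
Proof.
move=> [s [_ ->]]; apply: add_Z_grid; first exact: finite_seq.
by rewrite /= inE eqxx.
Qed.

(** If two of [x], [y], [x + y] are not breakpoints, they are strictly inside their intervals, and
    the face contains a short segment along which the third is constant. *)
Lemma vertex_two_breakpoints (R : realType) (B : set R) (p : R * R) :
  vertex (complex B) p -> two_breakpoints B p.
Proof.
move=> [I [J [K [cI cJ cK E]]]].
have pE (q : R * R) : face I J K q -> q = p by rewrite -E.
have [pI pJ pK] : face I J K p by rewrite -E.
have [a [b [[Ba Bb _ _] EI]]] := complex_cell cI pI.
have [c [d [[Bc Bd _ _] EJ]]] := complex_cell cJ pJ.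
have [e [g [[Be Bg _ _] EK]]] := complex_cell cK pK.
rewrite EI EJ EK /= !in_itv/= in pI pJ pK.
move: pI pJ pK => /andP[ax xb] /andP[cy yd] /andP[ew wg].
have strict (u v w : R) : B u -> B w -> u <= v <= w -> ~ B v -> u < v < w.
  move=> Bu Bw /andP[uv vw] nBv; rewrite !lt_neqAle uv vw !andbT.
  by apply/andP; split; apply: contra_notN nBv => /eqP; [move=> <-|move=> ->].
have inF q : a <= q.1 <= b -> c <= q.2 <= d -> e <= q.1 + q.2 <= g ->
    face I J K q by move=> ? ? ?; rewrite EI EJ EK; split; rewrite /= in_itv.
have [B1|n1] := pselect (B p.1).
  have [B2|n2] := pselect (B p.2); first exact: Or31.
  have [B3|n3] := pselect (B (p.1 + p.2)); first exact: Or32.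
  have /andP[h1 h2] : c < p.2 < d by apply: strict => //; rewrite cy yd.
  have /andP[h3 h4] : e < p.1 + p.2 < g by apply: strict => //; rewrite ew wg.
  pose t := Num.min (d - p.2) (g - (p.1 + p.2)).
  have t1 : t <= d - p.2 by rewrite ge_min lexx.
  have t2 : t <= g - (p.1 + p.2) by rewrite ge_min lexx orbT.
  have t0 : 0 < t by rewrite lt_min !subr_gt0 h2 h4.
  have /pE/(congr1 snd)/= : face I J K (p.1, p.2 + t).
    by apply: inF => /=; apply/andP; split; lra.
  by lra.
have /andP[h1 h2] : a < p.1 < b by apply: strict => //; rewrite ax xb.
have [B2|n2] := pselect (B p.2).
  have [B3|n3] := pselect (B (p.1 + p.2)); first exact: Or33.
  have /andP[h3 h4] : e < p.1 + p.2 < g by apply: strict => //; rewrite ew wg.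
  pose t := Num.min (b - p.1) (g - (p.1 + p.2)).
  have t1 : t <= b - p.1 by rewrite ge_min lexx.
  have t2 : t <= g - (p.1 + p.2) by rewrite ge_min lexx orbT.
  have t0 : 0 < t by rewrite lt_min !subr_gt0 h2 h4.
  have /pE/(congr1 fst)/= : face I J K (p.1 + t, p.2).
    by apply: inF => /=; apply/andP; split; lra.
  by lra.
(* Moving along (1, -1) keeps the sum, whether or not it is a breakpoint. *)
have /andP[h3 h4] : c < p.2 < d by apply: strict => //; rewrite cy yd.
pose t := Num.min (b - p.1) (p.2 - c).
have t1 : t <= b - p.1 by rewrite ge_min lexx.
have t2 : t <= p.2 - c by rewrite ge_min lexx orbT.
have t0 : 0 < t by rewrite lt_min !subr_gt0 h2 h3.
have /pE/(congr1 fst)/= : face I J K (p.1 + t, p.2 - t).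
  by apply: inF => /=; apply/andP; split; lra.
by lra.
Qed.

(** The two breakpoints, taken as singleton faces, determine the point; any cell containing the
    third number completes the triple. *)
Lemma two_breakpoints_vertex (R : realType) (B : set R) (p : R * R) :
  grid B -> two_breakpoints B p -> vertex (complex B) p.
Proof.
move=> gB.
have single (x : R) : B x -> complex B [set x] by move=> Bx; apply: Or32; exists x.
have xcell (x : R) : exists2 I, complex B I & I x.
  have [I [cI iI]] := cell_exists x gB; exists `[I.1, I.2]%classic.
    exact: cell_complex.
  by rewrite /= in_itv; exact: incell_le.
case: p => x y; rewrite /two_breakpoints /=; case=> [[Bx By]|[Bx Bxy]|[By Bxy]].
- have [K cK Kxy] := xcell (x + y).
  exists [set x], [set y], K; split; [exact: single|exact: single|by []|].
  by apply/seteqP; split=> [_ ->//|[u v] [/= -> ->]].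
- have [J cJ Jy] := xcell y.
  exists [set x], J, [set x + y]; split; [exact: single|by []|exact: single|].
  by apply/seteqP; split=> [_ ->//|[u v] [/= -> _ /addrI ->]].
- have [J cJ Jx] := xcell x.
  exists J, [set y], [set x + y]; split; [by []|exact: single|exact: single|].
  by apply/seteqP; split=> [_ ->//|[u v] [/= _ -> /addIr ->]].
Qed.

Lemma finite_Vset (R : realType) (pi : R -> R) (B : set R) :
  breakpoint_set B -> finite_set (Vset pi B).
Proof.
move=> [s [_ BE]]; set Q := [set x | x \in 0 :: s] in BE.
have finQ : finite_set Q by exact: finite_seq.
pose Q2 := Q `|` ([set x + y | x in Q & y in Q] `|` [set x - y | x in Q & y in Q]).
have finQ2 : finite_set Q2.
  by rewrite !finite_setU; do !split => //; exact: finite_image2.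
apply: sub_finite_set (finite_add_Z finQ2) => v [[x [y [[vert _] hv]]] v01].
split; last by move: v01; rewrite /= !in_itv/= => /andP[-> h]; lra.
have q1 u : B u -> add_Z Q2 u by rewrite BE => -[q Qq zE]; exists q => //; left.
have qD u w : B u -> B w -> add_Z Q2 (u + w).
  rewrite BE => -[q Qq [m ->]] [r Qr [n ->]]; exists (q + r).
    by right; left; exists q => //; exists r.
  by exists (m + n); rewrite intrD; ring.
have qB u w : B u -> B w -> add_Z Q2 (u - w).
  rewrite BE => -[q Qq [m ->]] [r Qr [n ->]]; exists (q - r).
    by right; right; exists q => //; exists r.
  by exists (m - n); rewrite intrB; ring.
have xE : x = (x + y) - y by ring.
have yE : y = (x + y) - x by ring.
case: (vertex_two_breakpoints vert) => /= -[h1 h2]; case: hv => ->.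
- exact: q1.
- exact: q1.
- exact: qD.
- exact: q1.
- by rewrite yE; exact: qB.
- exact: q1.
- by rewrite xE; exact: qB.
- exact: q1.
- exact: q1.
Qed.

(** A point of the closure outside an interval lies below or above all of it, so it is the infimum
    or the supremum. *)
Lemma finite_boundary_itv (R : realType) (J : set R) :
  is_interval J -> finite_set (closure J `\` J).
Proof.
move=> iJ; apply: (@sub_finite_set _ _ [set inf J; sup J]); last first.
  by rewrite finite_setU; split; exact: finite_set1.
move=> x [cJ nJ].
have [below|nbelow] := pselect (forall y, J y -> x < y).
  left; apply/esym/eqP; rewrite eq_le; apply/andP; split.
    apply/ler_addgt0Pr => e e0.
    have [y [Jy xy]] := cJ _ (nbhsx_ballx x _ e0).
    have h : has_inf J by split; [exists y|exists x => z /below/ltW].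
    apply: le_trans (ge_inf h.2 Jy) _.
    by move: xy; rewrite /ball/= ltr_norml => /andP[? ?]; lra.
  have [y [Jy _]] := cJ _ (nbhsx_ballx x 1 ltr01).
  by apply: lb_le_inf; [exists y|move=> z /below/ltW].
right.
have above z : J z -> z < x.
  move=> Jz; rewrite ltNge; apply/negP => xz; apply: nbelow => y Jy.
  rewrite ltNge; apply/negP => yx; apply: nJ; apply: (iJ y z) => //.
  by rewrite yx xz.
apply/eqP; rewrite eq_le; apply/andP; split.
  apply/ler_addgt0Pr => e e0.
  have [y [Jy xy]] := cJ _ (nbhsx_ballx x _ e0).
  have h : has_sup J by split; [exists y|exists x => z /above/ltW].
  have := ub_le_sup h.2 Jy.
  by move: xy; rewrite /ball/= ltr_norml => /andP[? ?]; lra.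
have [y [Jy _]] := cJ _ (nbhsx_ballx x 1 ltr01).
by apply: ge_sup; [exists y|move=> z /above/ltW].
Qed.

Lemma finite_boundary_bigcup (R : realType) (I : choiceType) (A : set I)
    (F : I -> set R) : finite_set A ->
  (forall i, A i -> finite_set (closure (F i) `\` F i)) ->
  finite_set (closure (\bigcup_(i in A) F i) `\` \bigcup_(i in A) F i).
Proof.
move=> finA H; apply: sub_finite_set (bigcup_finite finA H) => x [cx nx].
have : closed (\bigcup_(i in A) closure (F i)).
  by apply: closed_bigcup => // i _; exact: closed_closure.
move=> /closure_id E.
have /closure_subset/(_ x cx) : \bigcup_(i in A) F i `<=` \bigcup_(i in A) closure (F i).
  by move=> y [i Ai Fy]; exists i => //; exact: subset_closure.
rewrite -E => -[i Ai cFx]; exists i => //; split => // Fx.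
by apply: nx; exists i.
Qed.

Lemma covered_bigcup (R : realType) (C : seq (set R)) :
  covered C = \bigcup_(D in [set D | D \in C]) D.
Proof. by apply/seteqP; split=> x [D DC Dx]; exists D. Qed.

Lemma open_covered (R : realType) (C : seq (set R)) :
  (forall D, D \in C -> fin_union_open_itv D) -> open (covered C).
Proof.
move=> hC; rewrite covered_bigcup; apply: bigcup_open => D /hC[n [J [oJ _ ->]]].
by apply: bigcup_open => i _; have [] := oJ i.
Qed.

Lemma finite_Xset (R : realType) (C : seq (set R)) :
  (forall D, D \in C -> fin_union_open_itv D) -> finite_set (Xset C).
Proof.
move=> hC; rewrite !finite_setU; split; last exact: finite_set1.
split; first exact: finite_set1.
rewrite (interior_id _).1; last exact: open_covered.
rewrite covered_bigcup; apply: finite_boundary_bigcup; first exact: finite_seq.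
move=> D /hC[n [J [oJ _ ->]]]; apply: finite_boundary_bigcup => [|i _].
  exact: finite_finset.
by apply: finite_boundary_itv; have [] := oJ i.
Qed.

Lemma finite_Yset (R : realType) (pi : R -> R) (B : set R) (W : set (move R))
    (C : seq (set R)) : breakpoint_set B -> ensemble W -> finite_set W ->
  finite_set (Yset pi B W C).
Proof.
move=> hB eW finW; have finV := finite_Vset pi hB.
rewrite finite_setU; split; first exact: sub_finite_set (@subIsetl _ _ _) finV.
apply: (@sub_finite_set _ _ (\bigcup_(m in W) \bigcup_(x in Vset pi B)
    [set y | m.2 (x, y)])).
  by move=> y [x [g [D [[Vx _] Dx Wm ->]]]]; exists (restr g D) => //; exists x.
apply: bigcup_finite => // m /eW[g [D [_ ->]]]; apply: bigcup_finite => // x _.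
by apply: sub_finite_set (finite_set1 (g x)) => y [/= _ ->].
Qed.

(** A reflection with parameter [r] fixes only [r / 2]. The type component of a move excludes
    translations, among which the identity fixes every point. *)
Lemma finite_Zset (R : realType) (W : set (move R)) (C : seq (set R)) :
  ensemble W -> finite_set W -> finite_set (Zset W C).
Proof.
move=> eW finW; apply: (@sub_finite_set _ _ (\bigcup_(m in W)
    [set x | m.1 /\ m.2 (x, x)])).
  by move=> x [_ [r [D [Wm Dx xE]]]]; exists (restr (Rho r) D).
apply: bigcup_finite => // m /eW[g [D [_ ->]]].
case: g => [t|r]; first by apply: sub_finite_set (finite_set0 R) => x [].
by apply: sub_finite_set (finite_set1 (r / 2)) => x [_ [/= _ E]]; rewrite /=; lra.
Qed.

(** * Minimality of the breakpoints *)

Lemma next_breakpoint (R : realType) (B : set R) (x : R) : grid B ->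
  exists c, [/\ x < c, B c & forall y, x < y < c -> ~ B y].
Proof.
move=> gB; have [B0 BD /finite_seqP[s sE]] := gB.
have inB y : y \in s <-> B y /\ 0 <= y <= 2.
  by have /= := congr1 (fun S => S y) sE; rewrite in_itv/= => <-.
have B2 : B 2 by have := BD 0 2 B0; rewrite add0r.
have /andP[f0 f1] := floor_frac x; set n := Num.floor x in f0 f1.
have [|c [cs _ cmin]] := @exists_min_ge R [seq y <- s | x - n%:~R < y] 0.
  by exists 2 => //; rewrite mem_filter; apply/andP; split;
    [lra|apply/inB; rewrite lexx ler0n].
move: cs; rewrite mem_filter => /andP[xc /inB[Bc /andP[c0 c2]]].
exists (c + n%:~R); split; [lra|exact: BD|].
move=> y /andP[xy yc] By; have By' : B (y - n%:~R) by rewrite -mulrNz; exact: BD.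
suff : c <= y - n%:~R by lra.
apply: cmin; last by lra.
rewrite mem_filter; apply/andP; split; first by lra.
by apply/inB; split => //; apply/andP; split; lra.
Qed.

Lemma prev_breakpoint (R : realType) (B : set R) (x : R) : grid B -> 0 < x <= 1 ->
  exists a, [/\ a < x, B a & forall y, a < y < x -> ~ B y].
Proof.
move=> gB /andP[x0 x1]; have [B0 BD /finite_seqP[s sE]] := gB.
have inB y : y \in s <-> B y /\ 0 <= y <= 2.
  by have /= := congr1 (fun S => S y) sE; rewrite in_itv/= => <-.
have [|a [as_ _ amax]] := @exists_max_le R [seq y <- s | y < x] 1.
  by exists 0 => //; rewrite mem_filter x0; apply/inB; rewrite lexx ler0n.
move: as_; rewrite mem_filter => /andP[ax /inB[Ba /andP[a0 _]]].
exists a; split => // y /andP[ay yx] By.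
suff : y <= a by lra.
apply: amax; last by lra.
by rewrite mem_filter yx; apply/inB; split => //; apply/andP; split; lra.
Qed.

Lemma int_lt1_eq0 (R : realType) (z : int) : -1 < (z%:~R : R) < 1 -> z = 0.
Proof.
move=> /andP[h1 h2]; apply/eqP; rewrite eq_le; apply/andP; split.
  by rewrite -ltzD1 add0r -(ltr_int R).
by rewrite -ltzD1 -(ltr_int R) intrD; lra.
Qed.

(* Otherwise b could be dropped from B. *)
Lemma minimal_breakpoints_not_affine (R : realType) (pi : R -> R) (B : set R)
    (a b c al be : R) : minimal_breakpoints pi B ->
  (forall x (z : int), pi (x + z%:~R) = pi x) ->
  0 < b < 1 -> B b -> cell B a b -> cell B b c -> a < b < c ->
  ~ forall x, a < x < c -> pi x = al * x + be.
Proof.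
move=> [hB pl minB] per /andP[b0 b1] Bb [Ba _ _ nab] [_ Bc _ nbc] /andP[ab bc] aff.
have gB := breakpoint_set_grid hB; have [B0 BD _] := gB.
have [s [ss BE]] := hB.
have sP := breakpoint_setE ss.
pose s' := [seq x <- s | x != b].
pose B' := add_Z [set x | x \in 0 :: s'].
have ss' : sorted <%R (0 :: rcons s' 1).
  have := sorted_filter lt_trans (fun x => x != b) ss.
  by rewrite /= filter_rcons (lt_eqF b0) (gt_eqF b1)/=.
have hB' : breakpoint_set B' by exists s'.
have gB' := breakpoint_set_grid hB'.
have B'B : B' `<=` B.
  rewrite BE => x [q /= qs zE]; exists q => //=; move: qs.
  by rewrite !inE mem_filter => /predU1P[->|/andP[_ ->]]; rewrite ?eqxx ?orbT.
have BB' x : B x -> (forall z : int, x <> b + z%:~R) -> B' x.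
  rewrite BE => -[q /= qs [z xE]] nx; exists q; last by exists z.
  move: qs; rewrite /= !inE => /predU1P[->|qs]; first by rewrite eqxx.
  rewrite mem_filter qs andbT; apply/orP; right; apply/eqP => qb.
  by apply: (nx z); rewrite -qb.
have nB'b : ~ B' b.
  move=> [q /= qs [z bE]].
  have /andP[q0 q1] : 0 <= q < 1.
    apply: sP; move: qs; rewrite !inE mem_filter => /predU1P[->|/andP[_ ->]].
      by rewrite eqxx.
    by rewrite orbT.
  have z0 : z = 0 by apply: (@int_lt1_eq0 R); apply/andP; split; lra.
  move: bE; rewrite z0 addr0 => bE; move: qs; rewrite -bE !inE mem_filter eqxx/=.
  by rewrite orbF (gt_eqF b0).
have a0 : 0 <= a.
  by rewrite leNgt; apply/negP => h; apply: (nab 0) => //; rewrite h b0.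
have B1 : B 1 by have := BD 0 1 B0; rewrite add0r.
have c1 : c <= 1.
  by rewrite leNgt; apply/negP => h; apply: (nbc 1) => //; rewrite h b1.
have noshift x : 0 <= x <= 1 -> x != b -> forall z : int, x <> b + z%:~R.
  move=> /andP[x0 x1] xb z xE; have z0 : z = 0.
    by apply: (@int_lt1_eq0 R); apply/andP; split; lra.
  by move: xb; rewrite xE z0 addr0 eqxx.
have B'a : B' a.
  by apply: BB' => //; apply: noshift; [apply/andP; split; lra|rewrite lt_eqF].
have B'c : B' c.
  by apply: BB' => //; apply: noshift; [apply/andP; split; lra|rewrite gt_eqF].
have pl' : piecewise_linear (complex B') pi.
  apply: complexP => p q [Bp Bq _ npq] pq.
  (* A cell of [B'] around a translate of [b] lies within the same translate of [[a, c]], where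
     periodicity transports the affine formula. Every other cell of [B'] is a cell of [B]. *)
  have [[z /andP[pz zq]]|nz] := pselect (exists z : int, p < b + z%:~R < q).
    have ap : a + z%:~R <= p.
      rewrite leNgt; apply/negP => h; apply: (npq (a + z%:~R)).
        by apply/andP; split; lra.
      exact: (gridD gB').
    have qc : q <= c + z%:~R.
      rewrite leNgt; apply/negP => h; apply: (npq (c + z%:~R)).
        by apply/andP; split; lra.
      exact: (gridD gB').
    exists al, (be - al * z%:~R) => x /andP[px xq].
    rewrite -(per x (- z)) aff mulrNz; first by ring.
    by apply/andP; split; lra.
  have [k kP] := pl_coef_exists pl.
  exists (k (p, q)).1, (k (p, q)).2 => x xpq; apply: kP => /=; last by right.
  split; [exact: B'B|exact: B'B|exact: ltW|].
  move=> y ypq By; apply: (npq y ypq); apply: BB' => // z yE.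
  by apply: nz; exists z; rewrite -yE.
(* Minimality puts the cell of [B'] around [b] inside a face of [B], which would then have the
   breakpoint [b] strictly inside. *)
have [[p q] /= [[Bp Bq pq' npq] bpq]] := cell_exists b gB'.
case: bpq => [[E _]|/andP[pb bq]]; first by apply: nB'b; rewrite -E.
have cpq : complex B' `[p, q]%classic by apply: cell_complex.
have [J cJ sub] := minB _ hB' pl' _ cpq.
have Jb : J b by apply: sub; rewrite /= in_itv/= !ltW.
have [u [v [[Bu Bv uv nuv] JE]]] := complex_cell cJ Jb.
have Jp : J p by apply: sub; rewrite /= in_itv/= lexx.
have Jq : J q by apply: sub; rewrite /= in_itv/= lexx andbT.
move: Jp Jq; rewrite JE /= !in_itv/= => /andP[up _] /andP[_ qv].
by apply: (nuv b) => //; apply/andP; split; lra.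
Qed.

(** * The semigroup of slope-preserving moves *)

Lemma uapp_inv (R : realType) (g : umap R) : cancel (uinv g) g.
Proof. by case: g => [t|r] x /=; rewrite ?subrK // subKr. Qed.

Lemma uapp_continuous (R : realType) (g : umap R) : continuous (uapp g).
Proof.
by case: g => [t|r] x /=; [apply: cvgD|apply: cvgB] => //; exact: cvg_cst.
Qed.

Lemma near_uapp (R : realType) (g : umap R) (x : R) (S : set R) :
  nbhs (g x) S -> \forall y \near x, S (g y).
Proof. exact: uapp_continuous. Qed.

Lemma is_interval_preimage (R : realType) (g : umap R) (D : set R) :
  is_interval D -> is_interval (g @^-1` D).
Proof.
case: g => [t|r] iD x y /= Dx Dy z /andP[xz zy].
  by apply: iD Dx Dy _ _; rewrite /= !lerD2r xz zy.
by apply: iD Dy Dx _ _; rewrite /= !lerD2l !lerN2 xz zy.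
Qed.

Lemma open_itv_or_emptyE (R : realType) (D : set R) :
  open_itv_or_empty D <-> open D /\ is_interval D.
Proof.
split=> [[[]//|->]|[oD iD]]; first by split; [exact: open0|move=> ?].
by have [->|/set0P] := eqVneq D set0; [right|left].
Qed.

Lemma image_umap (R : realType) (g : umap R) (D : set R) :
  g @` D = uinv g @^-1` D.
Proof.
apply/seteqP; split=> [_ [x Dx <-]|y Dy]; first by rewrite /= uinvK.
by exists (uinv g y) => //; rewrite uapp_inv.
Qed.

Lemma open_itv_preimage (R : realType) (g : umap R) (D : set R) :
  open_itv_or_empty D -> open_itv_or_empty (g @^-1` D).
Proof.
move=> /open_itv_or_emptyE[oD iD]; apply/open_itv_or_emptyE; split.
  by apply: open_comp => // x _; exact: uapp_continuous.
exact: is_interval_preimage.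
Qed.

Lemma open_itvI (R : realType) (D D' : set R) :
  open_itv_or_empty D -> open_itv_or_empty D' -> open_itv_or_empty (D `&` D').
Proof.
move=> /open_itv_or_emptyE[oD iD] /open_itv_or_emptyE[oD' iD'].
apply/open_itv_or_emptyE; split; first exact: openI.
move=> x y [Dx D'x] [Dy D'y] z xzy; split; [exact: iD xzy|exact: iD' xzy].
Qed.

Lemma is_move_dom (R : realType) (g : umap R) (D : set R) :
  is_move (restr g D) -> open_itv_or_empty D.
Proof.
move=> [g' [D' [oD' [_ E]]]]; suff -> : D = D' by [].
apply/seteqP; split=> x Dx.
  have : [set p | D p.1 /\ p.2 = g p.1] (x, g x) by [].
  by rewrite E => -[].
have : [set p | D' p.1 /\ p.2 = g' p.1] (x, g' x) by [].
by rewrite -E => -[].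
Qed.

Lemma umap_cvg_app (R : realType) (gs : nat -> umap R) (g : umap R) (x : R) :
  umap_cvg gs g -> (gs n x @[n --> \oo] --> g x) /\
                   (uinv (gs n) x @[n --> \oo] --> uinv g x).
Proof.
case: g => [t|r] [nr cp]; split.
- have c : (x + param (gs n)) @[n --> \oo] --> x + t by apply: cvgD cp; exact: cvg_cst.
  apply: cvg_trans c; apply: near_eq_cvg; near=> n.
  by have : is_refl (gs n) = false; [near: n|case: (gs n)].
- have c : (x - param (gs n)) @[n --> \oo] --> x - t by apply: cvgB cp; exact: cvg_cst.
  apply: cvg_trans c; apply: near_eq_cvg; near=> n.
  by have : is_refl (gs n) = false; [near: n|case: (gs n)].
- have c : (param (gs n) - x) @[n --> \oo] --> r - x by apply: cvgB => //; exact: cvg_cst.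
  apply: cvg_trans c; apply: near_eq_cvg; near=> n.
  by have : is_refl (gs n) = true; [near: n|case: (gs n)].
- have c : (param (gs n) - x) @[n --> \oo] --> r - x by apply: cvgB => //; exact: cvg_cst.
  apply: cvg_trans c; apply: near_eq_cvg; near=> n.
  by have : is_refl (gs n) = true; [near: n|case: (gs n)].
Unshelve. all: by end_near. Qed.

(** A two-sided local condition: there is no slope at a kink or a jump, so statements about all
    slopes at such a point are vacuous. *)
Definition slope (R : realType) (pi : R -> R) (x a : R) : Prop :=
  exists c, \forall y \near x, pi y = a * y + c.

Lemma near_slope (R : realType) (pi : R -> R) (x a : R) :
  slope pi x a -> \forall y \near x, slope pi y a.
Proof.
move=> [c /nbhs_interior nc]; near=> y; exists c.
by have : (interior [set y | pi y = a * y + c]) y by near: y.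
Unshelve. all: by end_near. Qed.

Lemma slope_off_breakpoints (R : realType) (B : set R) (pi : R -> R) k (y : R)
    (I : R * R) : pl_coef B pi k -> cell B I.1 I.2 -> I.1 < y < I.2 ->
  slope pi y (k I).1.
Proof.
move=> kP cI /andP[h1 h2]; exists (k I).2; near=> z; apply: kP => //; right.
by apply/andP; split; near: z; [exact: lt_nbhsr|exact: lt_nbhsl].
Unshelve. all: by end_near. Qed.

(** Points just to the right of [x], before the next breakpoint, have a slope. *)
Lemma slope_dense (R : realType) (B : set R) (pi : R -> R) (x : R) (S : set R) :
  grid B -> piecewise_linear (complex B) pi -> nbhs x S ->
  exists y a, S y /\ slope pi y a.
Proof.
move=> gB /pl_coef_exists[k kP] /nbhs_normP[e /= e0 he].
have [c [xc Bc nB]] := next_breakpoint x gB.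
pose y := x + Num.min (e / 2) ((c - x) / 2).
have y1 : y <= x + e / 2 by rewrite lerD2l ge_min lexx.
have y2 : y <= x + (c - x) / 2 by rewrite lerD2l ge_min lexx orbT.
have y0 : x < y by rewrite ltrDl lt_min; apply/andP; split; lra.
have nBy : ~ B y by apply: nB; rewrite y0; lra.
have [I [cI iI]] := cell_exists y gB.
exists y, (k I).1; split.
  by apply: he => /=; rewrite ltr_norml; apply/andP; split; lra.
apply: (slope_off_breakpoints kP cI); case: iI => // -[E _].
by case: nBy; rewrite -E; case: cI.
Qed.

(** This depends on the pair only, not on the move relating it. Being vacuous at kinks, it is not
    transitive point by point; transitivity is recovered on open domains through nearby points that
    have a slope. *)
Definition same_slope (R : realType) (pi : R -> R) (p : R * R) : Prop :=
  [/\ cont_set pi p.1, cont_set pi p.2 &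
      forall a a', slope pi p.1 a -> slope pi p.2 a' -> a = a'].

Lemma same_slope_sym (R : realType) (pi : R -> R) (x y : R) :
  same_slope pi (x, y) -> same_slope pi (y, x).
Proof. by move=> [Ax Ay s]; split=> // a a' sa sa'; apply/esym/s. Qed.

Definition slope_moves (R : realType) (pi : R -> R) : set (move R) :=
  [set m | is_move m /\ forall p, m.2 p -> same_slope pi p].

Lemma slope_moves_restr (R : realType) (pi : R -> R) (g : umap R) (D : set R) :
  slope_moves pi (restr g D) <->
  open_itv_or_empty D /\ forall x, D x -> same_slope pi (x, g x).
Proof.
split=> [[/is_move_dom oD H]|[oD H]]; split=> //.
- by move=> x Dx; apply: H.
- by exists g, D.
- by move=> [x y] /= [Dx ->]; exact: H.
Qed.

(** Every point of the rectangle lies on the graph of a translation and on that of a reflection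
    within it, so both inclusions express the same pointwise property. This gives the kaleidoscope
    axiom. *)
Lemma moves_rectangle (R : realType) (pi : R -> R) (D I : set R) :
  open_itv_or_empty D -> open_itv_or_empty I ->
  (moves_pl (D `*` I) `<=` slope_moves pi <->
     forall x y, D x -> I y -> same_slope pi (x, y)) /\
  (moves_mi (D `*` I) `<=` slope_moves pi <->
     forall x y, D x -> I y -> same_slope pi (x, y)).
Proof.
move=> oD oI; split; split=> [H x y Dx Iy|H m].
- have /slope_moves_restr[_ /(_ x)] :
      slope_moves pi (restr (Tau (y - x)) (D `&` Tau (y - x) @^-1` I)).
    apply: H; exists (y - x), (D `&` Tau (y - x) @^-1` I); split => //.
      by apply: open_itvI => //; exact: open_itv_preimage.
    by move=> [u v] /= [[Du Iv] ->].
  have -> : Tau (y - x) x = y by rewrite /= addrC subrK.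
  by apply; split=> //=; rewrite addrC subrK.
- move=> [t [E [oE -> sub]]]; apply/slope_moves_restr; split => // x Ex.
  by have [] := sub (x, Tau t x); [|move=> Dx Iy; apply: H].
- have /slope_moves_restr[_ /(_ x)] :
      slope_moves pi (restr (Rho (y + x)) (D `&` Rho (y + x) @^-1` I)).
    apply: H; exists (y + x), (D `&` Rho (y + x) @^-1` I); split => //.
      by apply: open_itvI => //; exact: open_itv_preimage.
    by move=> [u v] /= [[Du Iv] ->].
  have -> : Rho (y + x) x = y by rewrite /= addrK.
  by apply; split=> //=; rewrite addrK.
- move=> [t [E [oE -> sub]]]; apply/slope_moves_restr; split => // x Ex.
  by have [] := sub (x, Rho t x); [|move=> Dx Iy; apply: H].
Qed.

Lemma slope_moves_closed (R : realType) (B : set R) (pi : R -> R) :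
  grid B -> piecewise_linear (complex B) pi ->
  closed_semigroup (cont_set pi) (slope_moves pi).
Proof.
move=> gB pl; split.
- by move=> m [].
- move=> g1 D1 g2 D2 /slope_moves_restr[oD1 H1] /slope_moves_restr[oD2 H2].
  apply/slope_moves_restr; split.
    by apply: open_itvI => //; exact: open_itv_preimage.
  move=> x [D1x D2x]; rewrite ucompE /=.
  have [A1 A2 _] := H1 x D1x; have [_ A3 _] := H2 _ D2x; split => // a a' sa sa'.
  have /open_itv_or_emptyE[opD1 _] := oD1.
  have /open_itv_or_emptyE[opD2 _] := oD2.
  (* The intermediate point [g1 x] may be a kink. It is replaced by a nearby [y] with a slope, while
     the slopes at both ends persist. *)
  have nb : \forall y \near g1 x, [/\ D1 (uinv g1 y), D2 y,
      slope pi (uinv g1 y) a & slope pi (g2 y) a'].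
    have n1 : \forall y \near g1 x, D1 (uinv g1 y).
      by apply: (@near_uapp R _ _ D1); rewrite uinvK; exact: open_nbhs_nbhs.
    have n2 : \forall y \near g1 x, D2 y by exact: open_nbhs_nbhs.
    have n3 : \forall y \near g1 x, slope pi (uinv g1 y) a.
      by apply: (@near_uapp R _ _ (slope pi ^~ a)); rewrite uinvK; exact: near_slope.
    have n4 : \forall y \near g1 x, slope pi (g2 y) a'.
      by apply: (@near_uapp R _ _ (slope pi ^~ a')); exact: near_slope.
    by near=> y; split; near: y.
  have [y [c [[D1y D2y s1 s2] sc]]] := slope_dense gB pl nb.
  have [_ _ E1] := H1 _ D1y; rewrite /= uapp_inv in E1.
  have [_ _ E2] := H2 _ D2y.
  by rewrite (E1 a c)//; exact: E2.
- move=> g D /slope_moves_restr[oD H]; apply/slope_moves_restr; split.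
    by rewrite image_umap; exact: open_itv_preimage.
  by move=> _ [x Dx <-]; rewrite uinvK; apply: same_slope_sym; exact: H.
- move=> g D D' /slope_moves_restr[oD H] D'D oD'; apply/slope_moves_restr.
  by split => // x /D'D; exact: H.
- move=> g F H oD; apply/slope_moves_restr; split; first by left.
  by move=> x [I /H/slope_moves_restr[_ HI] /HI].
- move=> g F D H oD sub; apply/slope_moves_restr; split => // x Dx.
  have [[cx Ax] Agx] := sub x Dx; split => // a a' sa sa'.
  (* Slopes persist nearby, and [x] is a limit of points of the given domains, where the slopes are
     known to agree. *)
  have nb : \forall y \near x, slope pi y a /\ slope pi (g y) a'.
    have n1 := near_slope sa.
    have n2 : \forall y \near x, slope pi (g y) a'.
      by apply: (@near_uapp R _ _ (slope pi ^~ a')); exact: near_slope.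
    by near=> y; split; near: y.
  have [y [[I /H/slope_moves_restr[_ HI] /HI[_ _ E]] [s1 s2]]] := cx _ nb.
  exact: E.
- move=> gs g D oD H cg; apply/slope_moves_restr; split; first by left.
  have [opD _ _] := oD.
  have H' n x : D x -> same_slope pi (x, gs n x).
    by have /slope_moves_restr[_] := H n; apply.
  move=> x Dx; have [Ax _ _] := H' 0%N x Dx; split => //=.
    (* For large [n] the preimage of [g x] under [gs n] is close to [x], hence in [D]. So [g x]
       itself is an image under a given move and is a continuity point. *)
    have [_ c] := umap_cvg_app (g x) cg; rewrite uinvK in c.
    have nD : nbhs x D by exact: open_nbhs_nbhs.
    have [n _ /(_ n (leqnn n))] := c _ nD => Dn.
    by have [_ /=] := H' n _ Dn; rewrite uapp_inv.
  move=> a a' sa /near_slope sa'; have [c _] := umap_cvg_app x cg.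
  have [n _ /(_ n (leqnn n)) sn] := c _ sa'.
  by have [_ _] := H' n x Dx; apply.
- move=> D I oD oI.
  have [E1 E2] := moves_rectangle pi (or_introl oD) (or_introl oI).
  by rewrite E1 E2.
Unshelve. all: by end_near. Qed.

Lemma cont_set_continuous (R : realType) (pi : R -> R) (x : R) :
  cont_set pi x -> {for x, continuous pi}.
Proof. by move=> [O [_ _ cO] Ox]; exact: cO. Qed.

(** * Initial moves preserve slopes *)

Definition sgn_umap (R : realType) (g : umap R) : R := if is_refl g then -1 else 1.

(* [delta pi x u - pi u] resp. [delta pi x (u - x) + pi u] converges, by
   continuity at [g x], to the quantity below up to sign; so the limits of
   [delta pi] at two points on the same side of the parameter agree only if
   this quantity does. *)
Definition increment (R : realType) (pi : R -> R) (g : umap R) (x : R) : R :=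
  pi (g x) - sgn_umap g * pi x.

Definition delta_at (R : realType) (pi : R -> R) (g : umap R) (x u : R) : R :=
  if is_refl g then delta pi x (u - x) else delta pi x u.

(** Subtracting the two expressions cancels the common term [pi u], which need not converge at the
    parameter. The filter [F] stands for either one-sided one. *)
Lemma increment_lim (R : realType) (pi : R -> R) (g : umap R)
    (F : set_system R) (x1 x2 : R) : ProperFilter F -> F --> param g ->
  {for g x1, continuous pi} -> {for g x2, continuous pi} ->
  delta_at pi g x1 u @[u --> F] --> (0 : R) ->
  delta_at pi g x2 u @[u --> F] --> (0 : R) ->
  increment pi g x1 = increment pi g x2.
Proof.
rewrite /increment /delta_at /sgn_umap; case: g => [t|r] /= PF Ft c1 c2 d1 d2.
- have cc x : {for x + t, continuous pi} -> pi (x + u) @[u --> F] --> pi (x + t).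
    by move=> c; apply: continuous_cvg => //; apply: cvgD => //; exact: cvg_cst.
  have L : (pi x1 - pi x2 - pi (x1 + u) + pi (x2 + u)) @[u --> F] -->
      pi x1 - pi x2 - pi (x1 + t) + pi (x2 + t).
    by apply: cvgD (cc _ c2); apply: cvgB (cc _ c1); exact: cvg_cst.
  have L0 : (pi x1 - pi x2 - pi (x1 + u) + pi (x2 + u)) @[u --> F] --> (0 - 0 : R).
    have dB : (delta pi x1 u - delta pi x2 u) @[u --> F] --> (0 - 0 : R).
      exact: cvgB d1 d2.
    apply: cvg_trans dB; apply: near_eq_cvg.
    by near=> u; rewrite /delta /=; ring.
  have : pi x1 - pi x2 - pi (x1 + t) + pi (x2 + t) = 0 - 0.
    exact: (cvg_unique _ L L0).
  by rewrite /=; lra.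
- have cc x : {for r - x, continuous pi} -> pi (u - x) @[u --> F] --> pi (r - x).
    by move=> c; apply: continuous_cvg => //; apply: cvgB => //; exact: cvg_cst.
  have L : (pi x1 - pi x2 + pi (u - x1) - pi (u - x2)) @[u --> F] -->
      pi x1 - pi x2 + pi (r - x1) - pi (r - x2).
    by apply: cvgB (cc _ c2); apply: cvgD (cc _ c1); exact: cvg_cst.
  have L0 : (pi x1 - pi x2 + pi (u - x1) - pi (u - x2)) @[u --> F] --> (0 - 0 : R).
    have dB : (delta pi x1 (u - x1) - delta pi x2 (u - x2)) @[u --> F] -->
        (0 - 0 : R).
      exact: cvgB d1 d2.
    apply: cvg_trans dB; apply: near_eq_cvg.
    near=> u; rewrite /delta /=.
    have -> : x1 + (u - x1) = x2 + (u - x2) by ring.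
    ring.
  have : pi x1 - pi x2 + pi (r - x1) - pi (r - x2) = 0 - 0.
    exact: (cvg_unique _ L L0).
  by rewrite /=; lra.
Unshelve. all: by end_near. Qed.

(** The side of the limit may vary with the point. Among three points two use the same side, by the
    pigeonhole principle. *)
Lemma init_cond_increment (R : realType) (pi : R -> R) (g : umap R) (D : set R) :
  (forall x, D x -> {for g x, continuous pi}) -> init_cond pi g D ->
  forall x1 x2 x3, D x1 -> D x2 -> D x3 ->
    [\/ increment pi g x1 = increment pi g x2,
        increment pi g x1 = increment pi g x3 |
        increment pi g x2 = increment pi g x3].
Proof.
move=> cD ic x1 x2 x3 D1 D2 D3.
have [eq0|side] : (forall x, D x -> delta_at pi g x (param g) = 0) \/
    (forall x, D x -> delta_at pi g x u @[u --> (param g)^'+] --> (0 : R) \/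
                      delta_at pi g x u @[u --> (param g)^'-] --> (0 : R)).
  by move: ic; case: (g) => [t|r] /= [].
- apply: Or31; move: (eq0 _ D1) (eq0 _ D2).
  rewrite /increment /delta_at /sgn_umap /delta; case: (g) => [t|r] /=.
    by lra.
  have -> : x1 + (r - x1) = r by ring.
  have -> : x2 + (r - x2) = r by ring.
  by lra.
- have Fr : (param g)^'+ --> param g by exact: cvg_within.
  have Fl : (param g)^'- --> param g by exact: cvg_within.
  have rr y z : D y -> D z -> delta_at pi g y u @[u --> (param g)^'+] --> (0 : R) ->
      delta_at pi g z u @[u --> (param g)^'+] --> (0 : R) ->
      increment pi g y = increment pi g z.
    move=> Dy Dz d1 d2; exact: (increment_lim _ Fr (cD _ Dy) (cD _ Dz) d1 d2).
  have ll y z : D y -> D z -> delta_at pi g y u @[u --> (param g)^'-] --> (0 : R) ->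
      delta_at pi g z u @[u --> (param g)^'-] --> (0 : R) ->
      increment pi g y = increment pi g z.
    move=> Dy Dz d1 d2; exact: (increment_lim _ Fl (cD _ Dy) (cD _ Dz) d1 d2).
  case: (side _ D1) => h1; case: (side _ D2) => h2; case: (side _ D3) => h3;
    solve [ apply: Or31; solve [exact: rr|exact: ll]
          | apply: Or32; solve [exact: rr|exact: ll]
          | apply: Or33; solve [exact: rr|exact: ll] ].
Qed.

(** Near [x] the increment is affine in the offset, with coefficient [sgn_umap g * (a' - a)]. Among
    the offsets 0, [e / 3] and [e / 2] it takes some value twice, so the coefficient vanishes. *)
Lemma init_cond_slope (R : realType) (pi : R -> R) (g : umap R) (D : set R)
    (x a a' : R) : open D -> D x ->
  (forall x, D x -> {for g x, continuous pi}) -> init_cond pi g D ->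
  slope pi x a -> slope pi (g x) a' -> a = a'.
Proof.
move=> oD Dx cD ic [c nc] [c' nc'].
have n1 : \forall y \near x, D y by exact: open_nbhs_nbhs.
have n2 : \forall y \near x, pi (g y) = a' * g y + c'.
  exact: (near_uapp nc').
have : \forall y \near x, [/\ D y, pi y = a * y + c & pi (g y) = a' * g y + c'].
  by near=> y; split; near: y.
move=> /nbhs_normP[e /= e0 he].
have pt t : 0 <= t < e ->
    [/\ D (x + t), pi (x + t) = a * (x + t) + c & pi (g (x + t)) = a' * g (x + t) + c'].
  move=> /andP[t0 te]; apply: he => /=.
  by rewrite ltr_norml; apply/andP; split; lra.
have incE t : 0 <= t < e -> increment pi g (x + t) = increment pi g x +
    sgn_umap g * (a' - a) * t.
  move=> te; have [_ E1 E2] := pt _ te.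
  have [|_ F1 F2] := pt 0; first by rewrite lexx.
  rewrite addr0 in F1 F2; rewrite /increment E1 E2 F1 F2 /sgn_umap.
  by case: (g) => [s|r] /=; ring.
have s0 : sgn_umap g != 0 by rewrite /sgn_umap; case: ifP; rewrite ?oppr_eq0 oner_eq0.
have h0 : 0 <= (0 : R) < e by rewrite lexx.
have h1 : 0 <= e / 3 < e by apply/andP; split; lra.
have h2 : 0 <= e / 2 < e by apply/andP; split; lra.
have fin t : t != 0 -> sgn_umap g * (a' - a) * t = 0 -> a = a'.
  move=> t0 /eqP; rewrite !mulf_eq0 (negbTE s0) (negbTE t0) orbF /= subr_eq0.
  by move/eqP.
have [D0 _ _] := pt _ h0; have [D1 _ _] := pt _ h1; have [D2 _ _] := pt _ h2.
have := init_cond_increment cD ic D0 D1 D2; rewrite !incE//.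
case=> E.
- apply: (fin (e / 3)); [lra|].
  by move: E; rewrite mulr0; lra.
- apply: (fin (e / 2)); [lra|].
  by move: E; rewrite mulr0; lra.
- apply: (fin (e / 2 - e / 3)); [lra|].
  by rewrite mulrBr; lra.
Unshelve. all: by end_near. Qed.

Lemma init_dom_slope_moves (R : realType) (pi : R -> R) (g : umap R) (D : set R) :
  init_dom pi g D -> slope_moves pi (restr g D).
Proof.
move=> [oD DA gA ic]; apply/slope_moves_restr; split; first by left.
move=> x Dx; split; [exact: DA|by apply: gA; exists x|].
move=> a a'; apply: (@init_cond_slope R pi g D x) => //; first by case: oD.
by move=> y Dy; apply: cont_set_continuous; apply: gA; exists y.
Qed.

Lemma clsemi_slope_moves (R : realType) (B : set R) (pi : R -> R) :
  grid B -> piecewise_linear (complex B) pi ->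
  clsemi (cont_set pi) (initial_moves pi) `<=` slope_moves pi.
Proof.
move=> gB pl; have cs := slope_moves_closed gB pl.
apply: smallest_sub => // m [[->|->]|[g [D [gD ->]]]|[g [D [gD ->]]]].
- by apply/slope_moves_restr; split; [right|].
- by apply/slope_moves_restr; split; [right|].
- exact: init_dom_slope_moves.
- by apply: (cs_inv cs); exact: init_dom_slope_moves.
Qed.

(** * Breakpoints and covered points *)

Lemma covered_same_slope (R : realType) (pi : R -> R) (W : set (move R))
    (C : seq (set R)) (b : R) :
  (forall D, D \in C -> fin_union_open_itv D) ->
  join (W `|` moves_seq C) `<=` slope_moves pi -> covered C b ->
  \forall x \near b, \forall y \near b, same_slope pi (x, y).
Proof.
move=> hC sub [D DC Db]; have [n [J [oJ _ DE]]] := hC D DC.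
move: Db; rewrite DE => -[i _ Jb]; have oi := oJ i.
(* Translations inside the square of [J i] already join any two points of [J i], so all slopes near
   [b] are related. *)
have H : moves_pl (J i `*` J i) `<=` slope_moves pi.
  move=> m [t [E [oE mE mJ]]]; apply: sub => G [_]; apply; right; exists D => //.
  by left; exists t, E; split => // p /mJ[J1 J2]; rewrite DE; split; exists i.
have /((moves_rectangle pi (or_introl oi) (or_introl oi)).1) := H => {}H.
have nJ : \forall x \near b, J i x by apply: open_nbhs_nbhs; case: oi.
by apply: filterS (nJ) => x Jx; apply: filterS (nJ) => y Jy; exact: H.
Qed.

(** The affine pieces on both sides of [b] have equal slopes and, by continuity, the common value
    [pi b] at [b]. So they form one affine function, against minimality. *)
Lemma breakpoint_not_covered (R : realType) (f : R) (pi : R -> R) (B : set R)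
    (b : R) : minimal_valid f pi -> minimal_breakpoints pi B -> B b -> 0 < b < 1 ->
  ~ \forall x \near b, \forall y \near b, same_slope pi (x, y).
Proof.
move=> mv mB Bb b01 ns; have [hB pl _] := mB; have gB := breakpoint_set_grid hB.
have [k kP] := pl_coef_exists pl; have /andP[b0 b1] := b01.
have [|a [ab Ba nab]] := @prev_breakpoint R B b gB; first by rewrite b0 ltW.
have [c [bc Bc nbc]] := next_breakpoint b gB.
have cab : cell B a b by split => //; exact: ltW.
have cbc : cell B b c by split => //; exact: ltW.
have cont : {for b, continuous pi}.
  apply: cont_set_continuous.
  by have [] := nbhs_singleton (nbhs_singleton ns).
have slope_eq : (k (a, b)).1 = (k (b, c)).1.
  (* The neighbourhood for the second point depends on the first, so [x] is chosen to the left of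
     [b] before [y] to the right. *)
  have /nbhs_normP[e /= e0 he] := ns.
  have [x [xe xab]] : exists x, `|b - x| < e /\ a < x < b.
    exists (b - Num.min (e / 2) ((b - a) / 2)).
    have y1 : Num.min (e / 2) ((b - a) / 2) <= e / 2 by rewrite ge_min lexx.
    have y2 : Num.min (e / 2) ((b - a) / 2) <= (b - a) / 2 by rewrite ge_min lexx orbT.
    have y0 : 0 < Num.min (e / 2) ((b - a) / 2) by rewrite lt_min; apply/andP; split; lra.
    by split; [rewrite ltr_norml|]; apply/andP; split; lra.
  have /nbhs_normP[e' /= e0' he'] := he x xe.
  have [y [ye ybc]] : exists y, `|b - y| < e' /\ b < y < c.
    exists (b + Num.min (e' / 2) ((c - b) / 2)).
    have y1 : Num.min (e' / 2) ((c - b) / 2) <= e' / 2 by rewrite ge_min lexx.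
    have y2 : Num.min (e' / 2) ((c - b) / 2) <= (c - b) / 2 by rewrite ge_min lexx orbT.
    have y0 : 0 < Num.min (e' / 2) ((c - b) / 2) by rewrite lt_min; apply/andP; split; lra.
    by split; [rewrite ltr_norml|]; apply/andP; split; lra.
  have [_ _] := he' y ye; apply.
    exact: (@slope_off_breakpoints _ _ _ _ _ (a, b) kP).
  exact: (@slope_off_breakpoints _ _ _ _ _ (b, c) kP).
have linc I : lin (k I) x @[x --> b] --> lin (k I) b.
  by apply: cvgD; [apply: cvgM => //|]; exact: cvg_cst.
have Eab : lin (k (a, b)) b = pi b.
  have n1 : \forall x \near b^'-, lin (k (a, b)) x = pi x.
    have ltb : \forall x \near b^'-, x < b by exact: nbhs_left_lt.
    near=> x; apply/esym; apply: (kP (a, b)) => //; right.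
    by apply/andP; split; near: x => //; exact: nbhs_left_gt.
  have h1 : pi x @[x --> b^'-] --> lin (k (a, b)) b.
    by apply: cvg_trans (cvg_at_left_filter (linc (a, b))); exact: near_eq_cvg.
  exact: (cvg_unique _ h1 (cvg_at_left_filter cont)).
have Ebc : lin (k (b, c)) b = pi b.
  have n1 : \forall x \near b^'+, lin (k (b, c)) x = pi x.
    have gtb : \forall x \near b^'+, b < x by exact: nbhs_right_gt.
    near=> x; apply/esym; apply: (kP (b, c)) => //; right.
    by apply/andP; split; near: x => //; exact: nbhs_right_lt.
  have h1 : pi x @[x --> b^'+] --> lin (k (b, c)) b.
    by apply: cvg_trans (cvg_at_right_filter (linc (b, c))); exact: near_eq_cvg.
  exact: (cvg_unique _ h1 (cvg_at_right_filter cont)).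
apply: (@minimal_breakpoints_not_affine R pi B a b c (k (a, b)).1 (k (a, b)).2 mB).
- by case: mv.
- exact: b01.
- exact: Bb.
- exact: cab.
- exact: cbc.
- by rewrite ab bc.
- move=> x /andP[ax xc]; have [xb|bx|->] := ltgtP x b.
  + by rewrite (kP (a, b) cab)//; right; rewrite ax xb.
  + rewrite (kP (b, c) cbc); last by right; rewrite bx xc.
    move: Eab Ebc; rewrite /lin slope_eq => <- /addrI ->//.
  + by rewrite -Eab.
Unshelve. all: by end_near. Qed.

(** A breakpoint in (0, 1) belongs to V. Outside the closure of the covered set it is therefore in
    Y, on the boundary it is in X, and it cannot be covered. *)
Lemma breakpoints_refined (R : realType) (f : R) (pi : R -> R) (B : set R)
    (W : set (move R)) (C : seq (set R)) :
  minimal_valid f pi -> minimal_breakpoints pi B ->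
  (forall D, D \in C -> fin_union_open_itv D) ->
  join (W `|` moves_seq C) `<=` slope_moves pi ->
  B `<=` refined_breakpoints pi B W C.
Proof.
move=> mv mB hC sub; have [hB pl _] := mB; have gB := breakpoint_set_grid hB.
have [s [ss BE]] := hB; have sP := breakpoint_setE ss => x Bx.
have := Bx; rewrite {1}BE => -[b /= bs [z ->]]; exists b; last by exists z.
have Bb : B b by rewrite BE; exists b => //; exists 0; rewrite addr0.
have /andP[b0 b1] := sP b bs.
have [->|bn0] := eqVneq b 0; first by left; left; left; left.
have {}b0 : 0 < b by rewrite lt_neqAle eq_sym bn0.
have Vb : Vset pi B b.
  split; last by rewrite /= in_itv/= !ltW.
  exists b, 0; split; last by apply: Or31.
  have vb : vertex (complex B) (b, 0).
    by apply: two_breakpoints_vertex => //; apply: Or31; split => //; exact: grid0 gB.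
  (* The vertex [(b, 0)] is additive on its own singleton face, since [pi 0 = 0] gives
     [delta pi b 0 = 0]. *)
  split => //; exists [set (b, 0)]; split => // S.
  move=> /nbhs_singleton S0; apply: nearW => q [-> _] /=.
  by move: S0; rewrite /delta addr0 (mv_at0 mv) addr0 subrr.
have [cb|ncb] := pselect (closure (covered C) b); last first.
  by left; right; left; split => //; split => //; rewrite /= in_itv/= b0 b1.
have [ib|nib] := pselect (interior (covered C) b); last by left; left; left; right.
have b01 : 0 < b < 1 by rewrite b0 b1.
case: (breakpoint_not_covered mv mB Bb b01).
exact: covered_same_slope hC sub (nbhs_singleton ib).
Qed.

(** * Finite-dimensional perturbations *)

Lemma effective_delta_bound (R : realType) (f : R) (pi theta : R -> R) :
  effective_perturbations f pi theta ->
  exists2 M : R, 0 < M & forall x y, `|delta theta x y| <= M * delta pi x y.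
Proof.
move=> [e e0 [[_ _ _ _ s1 _] [_ _ _ _ s2 _]]]; exists e^-1; first by rewrite invr_gt0.
move=> x y; rewrite mulrC ler_pdivlMr// -[X in _ * X](gtr0_norm e0) -normrM ler_norml.
have := s1 x y; have := s2 x y; rewrite /delta => h1 h2.
by apply/andP; split; nra.
Qed.

Lemma delta_face_eq0_dominated (R : realType) (pi theta : R -> R) (M : R)
    (F : set (R * R)) (p : R * R) : 0 < M ->
  (forall x y, `|delta theta x y| <= M * delta pi x y) ->
  delta_face_eq pi F p 0 -> delta_face_eq theta F p 0.
Proof.
move=> M0 bd /cvgrPdist_lt h; apply/cvgrPdist_lt => e e0.
have eM : 0 < e / M by rewrite divr_gt0.
apply: filterS (h _ eM) => q /=; rewrite !sub0r !normrN => hq.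
apply: le_lt_trans (bd _ _) _; rewrite mulrC -ltr_pdivlMr//.
by apply: le_lt_trans hq; exact: ler_norm.
Qed.

(** Translates condition (iii), a statement on limits along faces, into one on values of affine
    functions. A vertex where the affine function of [pi] vanishes is additive by that very face. *)
Lemma grid_delta_bound (R : realType) (B : set R) (pi theta : R -> R) :
  grid B -> piecewise_linear (complex B) pi -> piecewise_linear (complex B) theta ->
  (forall x (z : int), pi (x + z%:~R) = pi x) ->
  (forall x (z : int), theta (x + z%:~R) = theta x) ->
  (forall x y, 0 <= delta pi x y) ->
  (forall p F, additive_vertex (complex B) pi p -> dcomplex (complex B) F ->
    F p -> delta_face_eq pi F p 0 -> delta_face_eq theta F p 0) ->
  exists2 M, 0 <= M & forall x y, `|delta theta x y| <= M * delta pi x y.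
Proof.
move=> gB /pl_coef_exists[kp kpP] /pl_coef_exists[kt ktP] perp pert d0 hyp.
apply: (delta_bound gB kpP ktP) => // I J K p q cI cJ cK qF pF p2 L0.
have dF : dcomplex (complex B) (cface I J K).
  exists `[I.1, I.2]%classic, `[J.1, J.2]%classic, `[K.1, K.2]%classic.
  by split=> //; exact: cell_complex.
have piF : delta_face_eq pi (cface I J K) p 0.
  by rewrite -L0; exact: delta_face_lin kpP cI cJ cK qF.
have av : additive_vertex (complex B) pi p.
  by split; [exact: two_breakpoints_vertex|exists (cface I J K)].
by rewrite -(delta_face_lin_unique ktP cI cJ cK qF pF (hyp _ _ av dF pF piF)).
Qed.

Lemma refined_breakpoints_grid (R : realType) (pi : R -> R) (B : set R)
    (W : set (move R)) (C : seq (set R)) : breakpoint_set B ->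
  ensemble W -> finite_set W -> (forall D, D \in C -> fin_union_open_itv D) ->
  grid (refined_breakpoints pi B W C).
Proof.
move=> hB eW fW hC; apply: add_Z_grid; last by left; left; left; left.
rewrite finite_setU; split; last exact: finite_Zset.
by rewrite finite_setU; split; [exact: finite_Xset|exact: finite_Yset].
Qed.

Unset Implicit Arguments.

Theorem lemma10p25 (R : realType) (f : R) (pi : R -> R) (B : set R)
    (Omega : set (move R)) (C : seq (set R)) (theta : R -> R)
    (hf : f \isn't a Num.int)
    (hpi : minimal_valid f pi)
    (h0 : pi x @[x --> 0^'+] --> pi 0 \/ pi x @[x --> 0^'-] --> pi 0)
    (hB : minimal_breakpoints pi B)
    (hpres : reduced_presentation
               (clsemi (cont_set pi) (initial_moves pi)) Omega C) :
  let T := refined_complex pi B Omega C in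
  fin_dim_perturbations f pi T theta <->
  [/\ piecewise_linear T theta,
      theta 0 = 0 /\ theta f = 0,
      forall (x : R) (t : int), theta x = theta (x + t%:~R) &
      forall (p : R * R) (F : set (R * R)),
        additive_vertex T pi p -> dcomplex T F -> F p ->
        delta_face_eq pi F p 0 -> delta_face_eq theta F p 0].
Proof.
move=> T; split=> [[eff pl]|[pl [t0 tf] per hyp]].
  have [M M0 bd] := effective_delta_bound eff; split => //.
  - case: eff => e e0 [[_ _ z1 f1 _ _] _]; split.
      move: z1; rewrite (mv_at0 hpi) add0r => /eqP.
      by rewrite mulf_eq0 (gt_eqF e0) => /eqP.
    move: f1; rewrite (mv_atf hpi) => /eqP; rewrite -subr_eq0 addrAC subrr add0r.
    by rewrite mulf_eq0 (gt_eqF e0) => /eqP.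
  - move=> x t; case: eff => e e0 [[_ p1 _ _ _ _] _].
    move: (p1 x t); rewrite (mv_periodic hpi) => /addrI /mulfI.
    by move=> -> //; rewrite gt_eqF.
  - by move=> p F _ _ _; exact: delta_face_eq0_dominated bd.
have [fp _] := hpres; have [hBset plB _] := hB.
have gB := breakpoint_set_grid hBset.
have gB' := refined_breakpoints_grid pi hBset (fp_ensemble fp) (fp_finite fp)
  (fp_components fp).
have sub : join (Omega `|` moves_seq C) `<=` slope_moves pi.
  by rewrite -(fp_join fp); exact: clsemi_slope_moves plB.
have BB' := breakpoints_refined hpi hB (fp_components fp) sub.
have plT := piecewise_linear_sub gB BB' plB.
have per' x (z : int) : theta (x + z%:~R) = theta x by rewrite -per.
have [M M0 bd] := grid_delta_bound gB' plT pl (mv_periodic hpi) per'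
  (mv_subadditive hpi) hyp.
have [kt ktP] := pl_coef_exists pl.
have [L bt] := grid_pl_bounded gB' ktP per'.
have bt' x : `|theta x| <= Num.max 1 L by rewrite le_max bt orbT.
have bp' x : `|pi x| <= Num.max 1 L by rewrite le_max (minimal_valid_le1 _ hpi).
(* The added 1 covers the case [M = 0]. *)
split => //; exists (M + 1)^-1; first by rewrite invr_gt0; lra.
have eM : `|(M + 1)^-1| * M <= 1.
  by rewrite gtr0_norm ?invr_gt0; [rewrite mulrC ler_pdivrMr; lra|lra].
split; first exact: minimal_valid_perturb bp' bt' per' t0 tf bd eM.
(* The function with the minus sign is the case of the opposite factor, which has the same absolute
   value. *)
have := minimal_valid_perturb hpi bp' bt' per' t0 tf bd (_ : `|- (M + 1)^-1| * M <= 1).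
rewrite normrN => /(_ eM).
by under [X in minimal_valid f X]funext do rewrite mulNr.
Qed.
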